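(* Let $|a|<a_0$ and let $\omega^a(x,t)=\frac{1}{1-t}F^a\!\left(\frac{x}{(1-t)^{1+\lambda(a)}}\right)$, $0\le t<1$, be the self-similar solutions described in the context. Then $\omega^a$ remains uniformly smooth up to the blow-up time away from $x=0$; that is, for every $b>0$ there is a constant $C(b)$ such that $$\sup_{(x,t)\in(\mathbb{R}\setminus(-b,b))\times[0,1)}|\omega^a(x,t)|\le C(b).$$ Moreover, $\omega^a$ remains in weak $L^{1+\lambda(a)}$ uniformly up to the blow-up time, i.e. $\omega^a\in L^\infty([0,1);L^{1+\lambda(a),\infty}(\mathbb{R}))$. Finally, $$\sup_{t\in[0,1)}\int_{-1}^1|\omega^a(x,t)|^p\,dx<\infty\qquad\text{for all }0<p<1+\lambda(a).$$
   Context: Conventions: $Hf(x)=\frac1\pi\,\mathrm{p.v.}\int_{\mathbb{R}}\frac{f(y)}{x-y}\,dy$ and $\Lambda^{-1}f(x)=\int_0^xHf(y)\,dy$. The equation under consideration is $\partial_t\omega+a\,u\,\partial_x\omega=2\omega\,\partial_xu$, $u=-\Lambda^{-1}\omega$ on $\mathbb{R}$, with parameter $a\in\mathbb{R}$. A function of the form $\frac{1}{1-t}F(x/(1-t)^{1+\lambda})$ solves it iff $F$ solves the profile equation $$F(z)+\big((1+\lambda)z-a\,\Lambda^{-1}F(z)\big)F'(z)+2F(z)HF(z)=0.$$ The solutions $\omega^a$ are constructed as follows. Put $F_0(z)=\frac{z}{1+z^2}$ (which solves the profile equation for $a=\lambda=0$). There are uniquely determined odd functions $F_n\in H^3(\mathbb{R})$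 with $F_n'(0)=0$ and real numbers $\lambda_n$, $n\ge1$, such that $$F_n+zF_n'+2HF_0\,F_n+2F_0\,HF_n=\sum_{j=0}^{n-1}\Lambda^{-1}(F_j)F_{n-1-j}'-z\sum_{j=1}^n\lambda_jF_{n-j}'-2\sum_{j=1}^{n-1}F_jHF_{n-j}\qquad(n\ge1).$$ There is an absolute constant $a_0>0$ such that for $|a|<a_0$ the series $F^a=F_0+\sum_{n\ge1}a^nF_n$ (in $H^3(\mathbb{R})$) and $\lambda(a)=\sum_{n\ge1}a^n\lambda_n$ converge, $1+\lambda(a)>0$, and $F^a$ solves the profile equation with $\lambda=\lambda(a)$. For $0<q<\infty$, weak $L^q$, denoted $L^{q,\infty}(\mathbb{R})$, is the set of measurable $f$ with $\sup_{s>0}s\,|\{x:|f(x)|>s\}|^{1/q}<\infty$, with this supremum as its quasi-norm. *)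

(* Defs.v *)
From HB Require Import structures.
From mathcomp Require Import all_boot all_order all_algebra.
From mathcomp Require Import all_classical all_reals all_analysis.

Set Implicit Arguments.
Unset Strict Implicit.
Unset Printing Implicit Defensive.

Import Order.TTheory GRing.Theory Num.Theory.
Import numFieldNormedType.Exports.

Local Open Scope classical_set_scope.
Local Open Scope ring_scope.

Section hilbert.
Context {R : realType}.
Local Notation mu := (@lebesgue_measure R).

(* The principal value excises a symmetric interval around x only: for f in
   L^2 the truncated integrals converge absolutely at infinity.  [lim] is a
   total operator, meaningful here since the limit exists at every x for f in
   H^1(R). *)
Definition hilbert (f : R -> R) (x : R) : R :=
  pi^-1 * lim ((fun e : R =>
    \int[mu]_(y in [set y | e < `|x - y|]) (f y / (x - y))) @ 0^'+).

(* The integral from 0 to x is oriented. *)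
Definition Lambda_inv (f : R -> R) (x : R) : R :=
  if 0 <= x then \int[mu]_(y in `[0, x]) hilbert f y
  else - \int[mu]_(y in `[x, 0]) hilbert f y.

End hilbert.

Section sobolev.
Context {R : realType}.
Local Notation mu := (@lebesgue_measure R).

Definition C1_compact_support (phi : R -> R) : Prop :=
  [/\ forall x, derivable phi x 1,
      continuous (derive1 phi) &
      exists M : R, forall x, M < `|x| -> phi x = 0].

(* Test functions are taken in C^1_c(R), as is usual for W^{1,p} on an
   interval; for f, g in L^2 this is equivalent to testing against
   C^oo_c(R). *)
Definition weak_derivative (f g : R -> R) : Prop :=
  forall phi, C1_compact_support phi ->
    \int[mu]_x (f x * derive1 phi x) = - \int[mu]_x (g x * phi x).

(* d lists f and its weak derivatives of order 1, ..., m, all in L^2; for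
   k > m, d k is unconstrained. *)
Definition sobolev_jet (m : nat) (f : R -> R) (d : nat -> R -> R) : Prop :=
  [/\ d 0%N = f,
      forall k, (k <= m)%N -> d k \in Lfun mu 2%:E &
      forall k, (k < m)%N -> weak_derivative (d k) (d k.+1)].

(* Weak derivatives are unique almost everywhere, so the infimum is over a
   single value if f is in H^m(R), and it is +oo otherwise. *)
Definition sobolev_norm (m : nat) (f : R -> R) : \bar R :=
  ereal_inf [set ((\sum_(k < m.+1) 'N[mu]_2%:E[EFin \o d k] `^ 2) `^ 2^-1)%E
            | d in sobolev_jet m f].

(* Elements of H^m(R), m >= 1, are identified with their continuous
   representatives, so that pointwise evaluation makes sense. *)
Definition sobolev (m : nat) (f : R -> R) : Prop :=
  continuous f /\ exists d, sobolev_jet m f d.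

(* S is the sum of the series of the u n in H^m(R). *)
Definition sobolev_sum (m : nat) (u : nat -> R -> R) (S : R -> R) : Prop :=
  sobolev m S /\
  sobolev_norm m (fun z => S z - \sum_(0 <= n < N) u n z) @[N --> \oo] --> 0%E.

End sobolev.

Section weak_Lebesgue.
Context {R : realType}.
Local Notation mu := (@lebesgue_measure R).

Definition weakL_norm (q : R) (f : R -> R) : \bar R :=
  ereal_sup [set (s%:E * mu [set x | (s < `|f x|)%R] `^ q^-1)%E
            | s in [set s : R | 0 < s]].

Definition weakL (q : R) (f : R -> R) : Prop :=
  measurable_fun setT f /\ (weakL_norm q f < +oo)%E.

(* u is written u x t. The supremum is over every t, not just almost every t. *)
Definition Linfty_weakL (q : R) (u : R -> R -> R) : Prop :=
  (forall t, t \in `[0, 1[ -> weakL q (u ^~ t)) /\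
  (ereal_sup [set weakL_norm q (u ^~ t) | t in `[0%R, 1%R[] < +oo)%E.

End weak_Lebesgue.

Section profiles.
Context {R : realType}.

Definition profile_equation (a l : R) (G : R -> R) : Prop :=
  forall z, G z + ((1 + l) * z - a * Lambda_inv G z) * derive1 G z
            + 2 * G z * hilbert G z = 0.

(* lam 0 plays no role. *)
Definition profile_expansion (F : nat -> R -> R) (lam : nat -> R) : Prop :=
  (forall z, F 0%N z = z / (1 + z ^+ 2)) /\
  forall n, (1 <= n)%N ->
    [/\ sobolev 3 (F n),
        forall z, F n (- z) = - F n z,
        derive1 (F n) 0 = 0 &
        forall z,
          F n z + z * derive1 (F n) z
            + 2 * hilbert (F 0%N) z * F n z + 2 * F 0%N z * hilbert (F n) z
          = \sum_(0 <= j < n) Lambda_inv (F j) z * derive1 (F (n - 1 - j)%N) z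
            - z * \sum_(1 <= j < n.+1) lam j * derive1 (F (n - j)%N) z
            - 2 * \sum_(1 <= j < n) F j z * hilbert (F (n - j)%N) z].

Definition lambda_partial (lam : nat -> R) (a : R) (N : nat) : R :=
  \sum_(1 <= n < N) a ^+ n * lam n.

Definition lambda_sum (lam : nat -> R) (a : R) : R :=
  limn (lambda_partial lam a).

Definition expansion_solves (F : nat -> R -> R) (lam : nat -> R) (a : R)
    (G : R -> R) : Prop :=
  [/\ sobolev_sum 3 (fun n z => a ^+ n * F n z) G,
      cvgn (lambda_partial lam a),
      0 < 1 + lambda_sum lam a &
      profile_equation a (lambda_sum lam a) G].

Definition self_similar (l : R) (G : R -> R) (x t : R) : R :=
  (1 - t)^-1 * G (x / (1 - t) `^ (1 + l)).

End profiles.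

(* Main.v *)
(* The three assertions follow from |F^a(z)| <= C (1 + |z|)^(-1/(1+lambda)), which
   by self-similarity reads |omega^a(x,t)| <= C ((1-t)^(1+lambda) + |x|)^(-1/(1+lambda)).

   Write G = F^a, c = 1 + lambda and u(z) = |z|^(1/c) G(z). The profile equation
   gives u' = u k with k = - (2 c z HG + a Lambda^(-1)G) / (c z (c z - a Lambda^(-1)G)),
   so u is bounded as soon as k is integrable at infinity. It suffices that
   |HG| is integrable against (1+|x|)^(-4/5): then Lambda^(-1)G = O((1+|z|)^(4/5)).
   Boundedness of H on L^2 is not needed for this. If P = |G| + |G'| + |G''|, then
   |HG| <= C P * (1+|.|)^(-1), and P in L^2 together with Young's inequality and
   Tonelli's theorem yields the weighted bound.

   The profile equation is only meaningful where G is differentiable; the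
   regularity is recovered from the weak derivatives by testing them against
   smoothed indicator functions at Lebesgue points. *)

Require Import Defs.
From HB Require Import structures.
From mathcomp Require Import all_boot all_order all_algebra.
From mathcomp Require Import all_classical all_reals all_analysis.
From mathcomp Require Import measurable_realfun ring lra.
Set Implicit Arguments.
Unset Strict Implicit.
Unset Printing Implicit Defensive.
Import Order.TTheory GRing.Theory Num.Theory.
Import numFieldNormedType.Exports.
Local Open Scope classical_set_scope.
Local Open Scope ring_scope.

(** * Continuous representatives of weakly differentiable functions *)

Section mollifier.
Context {R : realType}.
Local Notation mu := (@lebesgue_measure R).
Implicit Types (x y s : R).

(** Two obstacles shape the argument. [hilbert] is a total limit whose measurability is not
    established, so every integral of HG is bounded through the measurable extended-real majorant 6
    [potential]. And u may vanish, so u' = u k is not integrated through a logarithm: M is taken so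
    large that a majorant of |k| has integral at most 1/2 on |z| >= M, and comparing u with its
    maximum over an interval then costs a factor 2.

    The exponent 4/5 has to lie below 1, so that Lambda^(-1)G is sublinear and c z dominates a
    Lambda^(-1)G for large |z|, and above 1/2, because P is only known to be in L^2.

    Since test functions need only be C^1, piecewise quadratic splines serve as smoothed
    indicators. *)

Definition posqr s : R := Num.max 0 s ^+ 2.

Lemma is_derive_posqr s : is_derive s 1 posqr (2 * Num.max 0 s).
Proof.
have [s0|s0|->] : [\/ s < 0, 0 < s | s = 0].
  by case: (ltgtP s 0) => ?; [exact: Or31|exact: Or32|exact: Or33].
- rewrite max_l ?ltW// mulr0; apply: (@near_eq_is_derive _ _ _ (cst 0)).
  near=> t; rewrite /posqr /= max_l ?expr0n//.
  by apply/ltW; near: t; exact: lt_nbhsl.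
- rewrite max_r ?ltW//; apply: (@near_eq_is_derive _ _ _ (fun t : R => t ^+ 2)).
    near=> t; rewrite /posqr /= max_r//.
    by apply/ltW; near: t; exact: lt_nbhsr.
  by apply: (is_derive_eq (is_deriveX 2 (is_derive_id s (1:R)))); rewrite /GRing.scale /= mulr1.
- rewrite maxxx mulr0.
  have H : h^-1 *: ((posqr \o shift 0) (h *: (1:R)) - posqr 0) @[h --> (0:R)^'] --> (0:R).
    apply/cvgrPdist_le => e e0; near=> h.
    rewrite /posqr /= /shift /= /GRing.scale /= mulr1 addr0 maxxx expr0n /= subr0 sub0r normrN.
    have h0 : h != 0 by near: h; exact: nbhs_dnbhs_neq.
    rewrite normrM normfV.
    have h1 : `|h| <= e.
       by near: h; apply: dnbhs0_le.
    apply: le_trans h1.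
    rewrite ler_pdivrMl ?normr_gt0// -expr2 normrX ler_sqr ?nnegrE//.
    by case: (leP 0 h) => // _; rewrite normr0.
  apply: DeriveDef.
  + by apply/cvg_ex; exists 0.
  + by apply: cvg_lim H; exact: Rhausdorff.
Unshelve. all: by end_near. Qed.

(* The second difference of the positive part, and its C^1 primitive. *)
Definition tent s : R := Num.max 0 (s + 1) - 2 * Num.max 0 s + Num.max 0 (s - 1).

Definition smoothstep s : R := (posqr (s + 1) - 2 * posqr s + posqr (s - 1)) / 2.

Lemma is_derive_smoothstep s : is_derive s 1 smoothstep (tent s).
Proof.
have H c : is_derive s 1 (fun t => posqr (t + c)) (2 * Num.max 0 (s + c)).
  rewrite -[X in is_derive _ _ _ X]mulr1; apply: is_derive1_comp.
    exact: is_derive_posqr.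
  by apply: is_derive_eq; rewrite addr0.
have := H 1; have := H (-1); have := is_derive_posqr s => ? ? ?.
rewrite /smoothstep; apply: is_derive_eq.
by rewrite /GRing.scale/= /tent !mulr0 add0r; field.
Qed.

Lemma continuous_tent : continuous tent.
Proof.
move=> s; rewrite /tent.
have H c : {for s, continuous (fun t : R => Num.max 0 (t + c))}.
  apply: continuous_max; first exact: cvg_cst.
  by apply: cvgD; [exact: cvg_id|exact: cvg_cst].
apply: cvgD; last exact: H.
apply: cvgB; first exact: H.
apply: cvgM; first exact: cvg_cst.
by apply: continuous_max; [exact: cvg_cst|exact: cvg_id].
Qed.

Lemma tent_ge0 s : 0 <= tent s.
Proof. by rewrite /tent !maxEle; repeat case: ifPn => //; rewrite -?ltNge; lra. Qed.

Lemma tent_le1 s : tent s <= 1.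
Proof. by rewrite /tent !maxEle; repeat case: ifPn => //; rewrite -?ltNge; lra. Qed.

Lemma tent_eq0 s : 1 <= `|s| -> tent s = 0.
Proof.
by rewrite /tent ler_normr => /orP[] ?; rewrite !maxEle;
  repeat case: ifPn => //; rewrite -?ltNge; lra.
Qed.

Lemma smoothstep_eq0 s : s <= -1 -> smoothstep s = 0.
Proof.
by move=> s1; rewrite /smoothstep /posqr !max_l; [|lra|lra|lra]; rewrite expr0n/=; lra.
Qed.

Lemma smoothstep_eq1 s : 1 <= s -> smoothstep s = 1.
Proof.
by move=> s1; rewrite /smoothstep /posqr !max_r; [|lra|lra|lra]; field.
Qed.

Lemma smoothstep_itv s : 0 <= smoothstep s <= 1.
Proof.
by rewrite /smoothstep /posqr !maxEle; repeat case: ifPn => //; rewrite -?ltNge => *;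
  apply/andP; split; nra.
Qed.

End mollifier.

(** * Mollification at Lebesgue points *)

Section local_integrability.
Context {R : realType}.
Local Notation mu := (@lebesgue_measure R).
Implicit Types (f g : R -> R) (x y s : R).

Lemma Lfun2_measurable f : f \in Lfun mu 2%:E -> measurable_fun setT f.
Proof. by rewrite inE => /andP[]; rewrite inE. Qed.

Lemma Lfun2_integrableS f (A : set R) : measurable A -> (mu A < +oo)%E ->
  f \in Lfun mu 2%:E -> mu.-integrable A (EFin \o f).
Proof.
move=> mA Aoo f2; have mf := Lfun2_measurable f2.
apply: (@le_integrable _ _ _ mu _ mA _ (EFin \o (fun s => 1 + f s ^+ 2))).
- by apply/measurable_EFinP; exact: measurable_funTS.
- move=> s _ /=; rewrite lee_fin (ger0_norm (addr_ge0 ler01 (sqr_ge0 _))).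
  by rewrite ler_norml; apply/andP; split; nra.
- apply: (@integrableD _ _ _ mu _ mA (EFin \o cst 1) (EFin \o (fun s => f s ^+ 2))).
  apply: measurable_bounded_integrable => //.
  by exists 1; split => // M M1 s _; rewrite /= normr1 ltW.
  by apply: integrableS (Lfun2_integrable_sqr f2).
Qed.

Lemma Lfun2_locally_integrable f : f \in Lfun mu 2%:E -> locally_integrable setT f.
Proof.
move=> f2; split; [exact: Lfun2_measurable|exact: openT|] => K _ cK.
have mK := compact_measurable cK.
have /integrableP[] // := Lfun2_integrableS mK (compact_finite_measure cK) f2.
Qed.


(** The kernel, a tent of radius 1/(k+1) around x, is the derivative of a rescaled [smoothstep];
    this is what testing a weak derivative against [bump] produces. *)
Definition mollify f (k : nat) x : R :=
  \int[mu]_s (f s * (k.+1%:R * tent (k.+1%:R * (s - x)))).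

Lemma is_derive_smoothstep_scaled (k : nat) x s :
  is_derive s 1 (fun t => smoothstep (k.+1%:R * (t - x)))
    (k.+1%:R * tent (k.+1%:R * (s - x))).
Proof.
rewrite [X in is_derive _ _ _ X]mulrC; apply: is_derive1_comp.
  exact: is_derive_smoothstep.
by apply: is_derive_eq; rewrite /GRing.scale/= subr0 mulr1.
Qed.

Lemma continuous_tent_scaled (k : nat) x :
  continuous (fun s => k.+1%:R * tent (k.+1%:R * (s - x))).
Proof.
move=> s; apply: cvgM; first exact: cvg_cst.
apply: (@continuous_comp _ _ _ (fun s => k.+1%:R * (s - x)) tent); last exact: continuous_tent.
apply: cvgM; first exact: cvg_cst.
by apply: cvgB; [exact: cvg_id|exact: cvg_cst].
Qed.

(** The primitive [smoothstep] of the kernel rises from 0 to 1 across the ball. *)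
Lemma integral_tent (k : nat) x :
  \int[mu]_(s in ball x k.+1%:R^-1) (k.+1%:R * tent (k.+1%:R * (s - x))) = 1.
Proof.
rewrite ball_itv /Rintegral.
have k0 : 0 < k.+1%:R^-1 :> R by rewrite invr_gt0.
rewrite -(@integral_itv_bndoo _ _ _ _ true false); last first.
  apply/measurable_EFinP/measurable_funTS.
  by apply: continuous_measurable_fun; exact: continuous_tent_scaled.
rewrite (@continuous_FTC2 _ _ (fun t => smoothstep (k.+1%:R * (t - x)))).
- rewrite [x + _ - x]addrC addKr [x - _ - x]addrC addKr mulrN mulfV//.
  by rewrite smoothstep_eq1// smoothstep_eq0//= subr0.
- by move: (_^-1) k0 => r r0; lra.
- by apply: continuous_subspaceT; exact: continuous_tent_scaled.
- have cs t : {for t, continuous (fun t => smoothstep (k.+1%:R * (t - x)))}.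
    by apply/differentiable_continuous/derivable1_diffP; have [] := is_derive_smoothstep_scaled k x t.
  split.
  + by move=> t _; have [] := is_derive_smoothstep_scaled k x t.
  + exact/cvg_at_right_filter/cs.
  + exact/cvg_at_left_filter/cs.
- move=> t _; rewrite derive1E.
  by have [_ ->] := is_derive_smoothstep_scaled k x t.
Qed.

Lemma mollifyE f (k : nat) x :
  mollify f k x =
  \int[mu]_(s in ball x k.+1%:R^-1) (f s * (k.+1%:R * tent (k.+1%:R * (s - x)))).
Proof.
rewrite [RHS]Rintegral_mkcond; apply: eq_Rintegral => s _.
rewrite patchE; case: ifPn => // /negP sB.
rewrite tent_eq0 ?mulr0//.
rewrite leNgt; apply/negP => sx; apply: sB; rewrite inE /ball /=.
move: sx; rewrite normrM ger0_norm// -ltr_pdivlMl// mulr1.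
by rewrite distrC.
Qed.

(** The kernel has mass 1 and is at most k+1, twice the inverse measure of the ball. The error is
    therefore at most twice the mean of |f - f x| over the ball, which tends to 0 at a Lebesgue
    point. *)
Lemma mollify_cvg f x : f \in Lfun mu 2%:E -> lebesgue_pt f x ->
  mollify f k x @[k --> \oo] --> f x.
Proof.
move=> f2 fx; have mf := Lfun2_measurable f2.
have dk : davg f x k.+1%:R^-1 @[k --> \oo] --> 0%E.
  apply: (@cvg_comp _ _ _ (fun k => k.+1%:R^-1) (davg f x)) fx => P P0.
  have H0 : \forall k \near \oo, (0 < harmonic k :> R) -> P (harmonic k) := @cvg_harmonic R _ P0.
  by apply: (@filterS _ \oo _ _ _ _ H0) => k /(_ (harmonic_gt0 k)).
suff H (k : nat) : (`|mollify f k x - f x|%:E <= 2%:E * davg f x k.+1%:R^-1)%E.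
  have dk2 : (2%:E * davg f x k.+1%:R^-1)%E @[k --> \oo] --> 0%E.
    by rewrite -(mule0 2%:E); apply: cvgeZl.
  have d0 : `|mollify f k x - f x| @[k --> \oo] --> 0.
    apply: (@fine_cvg _ _ _ _ (fun k => `|mollify f k x - f x|%:E) 0).
    by apply: (squeeze_cvge _ (cvg_cst 0%E) dk2); near=> k; rewrite H lee_fin normr_ge0.
  apply/cvgrPdistC_le => e e0; have := @cvgr0_norm_le _ _ _ _ _ _ d0 _ e0.
  by move=> /(_ _); apply: filterS => k; rewrite normr_id.
set r := k.+1%:R^-1; have r0 : 0 < r :> R by rewrite invr_gt0.
set B := ball x r; have mB : measurable B by exact: measurable_ball.
pose psi s : R := k.+1%:R * tent (k.+1%:R * (s - x)).
have Boo : (mu B < +oo)%E by rewrite /B lebesgue_measure_ball ?ltry// ltW.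
have psi0 s : 0 <= psi s by rewrite mulr_ge0// tent_ge0.
have psik s : psi s <= k.+1%:R by rewrite ler_piMr// tent_le1.
have mpsi : measurable_fun setT psi.
  by apply: continuous_measurable_fun; exact: continuous_tent_scaled.
have bpsi : [bounded psi s | s in B].
  exists k.+1%:R; split => // M kM s _ /=.
  by rewrite ger0_norm//; apply: le_trans (psik s) (ltW _).
have ifB := Lfun2_integrableS mB Boo f2.
have ipsi : mu.-integrable B (EFin \o psi).
  by apply: measurable_bounded_integrable => //; exact: measurable_funTS.
have ifpsi : mu.-integrable B (EFin \o (fun s => f s * psi s)).
  have mpsiB : measurable_fun B psi by exact: measurable_funTS.
  exact: (@integrableMl _ _ _ mu _ mB (EFin \o f) psi ifB mpsiB bpsi).
have icpsi : mu.-integrable B (EFin \o (fun s => f x * psi s)).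
  exact: (@integrableZl _ _ _ mu _ mB (f x) _ ipsi).
have idiff : mu.-integrable B (EFin \o (fun s => f s * psi s - f x * psi s)).
  exact: (@integrableB _ _ _ mu _ mB _ _ ifpsi icpsi).
have -> : mollify f k x - f x = \int[mu]_(s in B) (f s * psi s - f x * psi s).
  rewrite RintegralB// RintegralZl// mollifyE.
  by have := integral_tent k x; rewrite -/r -/B -/psi => ->; rewrite mulr1.
rewrite EFin_normr_Rintegral//.
have /measurable_int midiff := idiff.
apply: (le_trans (le_abse_integral mu mB midiff)).
rewrite /davg /iavg -/r -/B.
have mc : measurable_fun B (fun s => `|(f s - f x)%:E|)%E.
  apply/measurableT_comp => //; apply/measurable_EFinP/measurable_funB => //.
  exact: measurable_funTS.
apply: (@le_trans _ _ (\int[mu]_(s in B) (k.+1%:R%:E * `|(f s - f x)%:E|))%E).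
  apply: ge0_le_integral => //.
  - exact/measurableT_comp.
  - exact: emeasurable_funM.
  - move=> s _ /=; rewrite -mulrBl normrM lee_fin mulrC.
    by rewrite ler_wpM2r// ger0_norm.
rewrite ge0_integralZl//.
rewrite /B (lebesgue_measure_ball _ (ltW r0)) muleA inver.
rewrite ifF; last by rewrite mulrn_eq0 /= gt_eqF.
rewrite -EFinM; apply: lee_wpmul2r; first exact: integral_ge0.
by rewrite lee_fin -(mulr_natl r 2) invfM mulrA mulfV// mul1r /r invrK.
Unshelve. all: by end_near. Qed.

End local_integrability.

(** * The increment formula for weak derivatives *)

Section weak_derivative_ftc.
Context {R : realType}.
Local Notation mu := (@lebesgue_measure R).
Implicit Types (f g : R -> R) (x y s : R).

Lemma integrable_mul_tent f (k : nat) x : f \in Lfun mu 2%:E ->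
  mu.-integrable setT (EFin \o (fun s => f s * (k.+1%:R * tent (k.+1%:R * (s - x))))).
Proof.
move=> f2; have mf := Lfun2_measurable f2.
pose B := ball x k.+1%:R^-1; have mB : measurable B by exact: measurable_ball.
have Boo : (mu B < +oo)%E by rewrite /B lebesgue_measure_ball ?ltry.
pose psi s : R := k.+1%:R * tent (k.+1%:R * (s - x)).
have mpsi : measurable_fun B psi.
  apply: measurable_funTS; apply: continuous_measurable_fun; exact: continuous_tent_scaled.
have bpsi : [bounded psi s | s in B].
  exists k.+1%:R; split => // M kM s _ /=.
  rewrite ger0_norm ?mulr_ge0// ?tent_ge0//; apply: le_trans (ltW kM).
  by rewrite ler_piMr// tent_le1.
have ifB := Lfun2_integrableS mB Boo f2.
have := @integrableMl _ _ _ mu _ mB (EFin \o f) psi ifB mpsi bpsi.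
move=> H; have := proj1 (@integrable_mkcond _ _ _ mu _ ((EFin \o f) \* (EFin \o psi))%E mB) H.
apply: eq_integrable => // s _.
rewrite patchE /=; case: ifPn => // /negP sB.
rewrite tent_eq0 ?mulr0// leNgt; apply/negP => sx; apply: sB; rewrite inE /B /ball /=.
by move: sx; rewrite normrM ger0_norm// -ltr_pdivlMl// mulr1 distrC.
Qed.

(** A smoothed indicator of [x, y]: its derivative is the difference of the kernels of [mollify] at
    x and at y. *)
Definition bump (k : nat) x y s : R :=
  smoothstep (k.+1%:R * (s - x)) - smoothstep (k.+1%:R * (s - y)).

Lemma is_derive_bump k x y s : is_derive s 1 (bump k x y)
  (k.+1%:R * tent (k.+1%:R * (s - x)) - k.+1%:R * tent (k.+1%:R * (s - y))).
Proof.
apply: is_deriveB; exact: is_derive_smoothstep_scaled.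
Qed.

Lemma derive1_bump k x y : derive1 (bump k x y) =
  fun s => k.+1%:R * tent (k.+1%:R * (s - x)) - k.+1%:R * tent (k.+1%:R * (s - y)).
Proof.
by apply/funext => s; rewrite derive1E; have [_ ->] := is_derive_bump k x y s.
Qed.

Lemma bump_eq0 k x y s : x <= y -> s \notin `[x - 1, y + 1] -> bump k x y s = 0.
Proof.
have : (1:R) <= k.+1%:R by rewrite ler1n.
rewrite /bump; move: (k.+1%:R) => K K1.
move=> xy; rewrite in_itv /= negb_and -!ltNge => /orP[sx|sy].
  by rewrite !smoothstep_eq0 ?subrr//; nra.
by rewrite !smoothstep_eq1 ?subrr//; nra.
Qed.

Lemma C1_compact_support_bump k x y : x <= y -> C1_compact_support (bump k x y).
Proof.
move=> xy; split.
- by move=> s; have [] := is_derive_bump k x y s.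
- rewrite derive1_bump => s; by apply: cvgB; exact: continuous_tent_scaled.
- exists (`|x| + `|y| + 1) => s Ms; apply: bump_eq0 => //.
  apply/negP; rewrite in_itv /= => /andP[xs sy].
  move: Ms; rewrite ltNge => /negP; apply.
  rewrite ler_norml; apply/andP; split.
    by have := ler_norm (- x); rewrite normrN; have := normr_ge0 y; lra.
  by have := ler_norm y; have := normr_ge0 x; lra.
Qed.

Lemma bump_norm_le1 k x y s : `|bump k x y s| <= 1.
Proof.
rewrite /bump; move: (smoothstep_itv (k.+1%:R * (s - x))) (smoothstep_itv (k.+1%:R * (s - y))).
by move=> /andP[? ?] /andP[? ?]; rewrite ler_norml; apply/andP; split; lra.
Qed.

Lemma smoothstep_cvg x s : s != x ->
  smoothstep (k.+1%:R * (s - x)) @[k --> \oo] --> (if x < s then 1 else 0 : R).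
Proof.
move=> sx; apply: cvg_near_cst; near=> k.
(* From this k on the argument lies outside ]-1, 1[, where [smoothstep] is 0 or 1, so the sequence
   is eventually constant. *)
have K : `|s - x|^-1 <= k.+1%:R.
  apply: le_trans (_ : k%:R <= _); last by rewrite ler_nat.
  by near: k; exact: nbhs_infty_ger.
have sx0 : 0 < `|s - x| by rewrite normr_gt0 subr_eq0.
move: K; rewrite -div1r ler_pdivrMr//.
case: ltgtP sx => // sx _.
  by rewrite gtr0_norm ?subr_gt0// => K; apply: smoothstep_eq1.
by rewrite ltr0_norm ?subr_lt0// mulrN => K; apply: smoothstep_eq0; rewrite lerNr.
Unshelve. all: by end_near. Qed.

Lemma bump_cvg x y s : x < y -> s != x -> s != y ->
  bump k x y s @[k --> \oo] --> (\1_`[x, y] s : R).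
Proof.
move=> xy sx sy; have := cvgB (smoothstep_cvg sx) (smoothstep_cvg sy).
move=> /(_ _); rewrite indicE mem_setE in_itv /=.
set a := (X in _ --> X); set b := (X in _ -> _ --> X); suff -> : a = b by exact.
rewrite /a /b; case: (ltgtP x s) sx => // ?; case: (ltgtP y s) sy => //= *;
  rewrite ?subr0 ?subrr ?sub0r//=; lra.
Qed.

(** Tested against [bump], the weak derivative relates two mollifications of f to an integral of g.
    The former converge at Lebesgue points, the latter by dominated convergence. *)
Lemma weak_derivative_sub f g x y : f \in Lfun mu 2%:E -> g \in Lfun mu 2%:E ->
  weak_derivative f g -> x < y -> lebesgue_pt f x -> lebesgue_pt f y ->
  f y - f x = \int[mu]_(s in `[x, y]) g s.
Proof.
move=> f2 g2 fg xy fx fy.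
have mg := Lfun2_measurable g2.
have mbump k : measurable_fun setT (bump k x y).
  apply: continuous_measurable_fun => s.
  by apply/differentiable_continuous/derivable1_diffP; have [] := is_derive_bump k x y s.
have Hk k : mollify f k x - mollify f k y = - \int[mu]_s (g s * bump k x y s).
  rewrite -fg; last exact/C1_compact_support_bump/ltW.
  rewrite derive1_bump -RintegralB//; [|exact: integrable_mul_tent..].
  by apply: eq_Rintegral => s _; exact/esym/mulrBr.
have L : mollify f k x - mollify f k y @[k --> \oo] --> f x - f y.
  by apply: cvgB; exact: mollify_cvg.
(* As k+1 >= 1, all bumps vanish outside [x - 1, y + 1], so |g| restricted to it dominates. *)
have mI : measurable (`[x - 1, y + 1] : set R) by [].
have igI : mu.-integrable setT ((fun s => (`|g s|)%:E) \_ `[x - 1, y + 1]).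
  apply: (proj1 (@integrable_mkcond _ _ _ mu _ (EFin \o (Num.norm \o g)) mI)); apply: integrable_norm.
  apply: Lfun2_integrableS => //.
  by rewrite lebesgue_measure_itv /=; case: ifP; rewrite ?ltry.
have [||||_ _ D] := @dominated_convergence _ _ _ mu setT measurableT
  (fun k => EFin \o (fun s => g s * bump k x y s))
  (EFin \o (fun s => g s * \1_`[x, y] s)) ((fun s => (`|g s|)%:E) \_ `[x - 1, y + 1])
  _ _ _ igI _.
- by move=> k; apply/measurable_EFinP; apply: measurable_funM; [exact: mg|exact: mbump].
- by apply/measurable_EFinP; apply: measurable_funM => //; exact: measurable_indic.
(* At the two endpoints the bumps tend to 1/2 and not to the indicator. *)
- exists [set x; y]; split.
  + by apply: measurableU; exact: measurable_set1.
  + apply/eqP; rewrite eq_le measure_ge0 andbT.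
    rewrite (le_trans (measureU2 _ _ _))//.
      have H z : mu [set z] = 0%E by exact: lebesgue_measure_set1.
      by have := lexx (0%E : \bar R); rewrite -{1}(adde0 0%E) -{1}(H x) -{1}(H y).
  + move=> s /= Hs; apply: contrapT => /not_orP[/eqP sx /eqP sy]; apply: Hs => _.
    by apply: cvg_EFin; [near=> k|apply: cvgM; [exact: cvg_cst|exact: bump_cvg]].
- apply: aeW => s k _ /=; rewrite patchE; case: ifPn => [_|/negP sI].
    by rewrite lee_fin normrM ler_piMr// bump_norm_le1.
  rewrite (bump_eq0 k (ltW xy)) ?mulr0 ?normr0; first exact: lexx.
  by apply/negP => sxy; apply: sI; rewrite inE.
have {}D : \int[mu]_s (g s * bump k x y s) @[k --> \oo] --> \int[mu]_(s in `[x, y]) g s.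
  have ixy : mu.-integrable `[x, y] (EFin \o g).
    by apply: Lfun2_integrableS => //; rewrite lebesgue_measure_itv /=; case: ifP; rewrite ?ltry.
  apply: (@fine_cvg _ _ _ _ (fun k => \int[mu]_s (g s * bump k x y s)%:E)%E).
  rewrite /Rintegral fineK; last exact: integrable_fin_num.
  rewrite integral_mkcond; move: D; congr (_ --> _).
  apply: eq_integral => s _; rewrite patchE /= indicE.
  by case: ifPn => _; rewrite ?mulr1 ?mulr0.
have /(cvg_unique _ L)-/(_ _) H : mollify f k x - mollify f k y @[k --> \oo] -->
    - \int[mu]_(s in `[x, y]) g s.
  by under eq_cvg do rewrite Hk; exact: cvgN.
by rewrite -opprB H ?opprK//; exact: Rhausdorff.
Unshelve. all: by end_near. Qed.

End weak_derivative_ftc.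

(** * Classical derivatives recovered from weak ones *)

Section sobolev_C1.
Context {R : realType}.
Local Notation mu := (@lebesgue_measure R).
Implicit Types (f g h : R -> R) (x y s : R).

Lemma Lfun2_integrable_itv f x y : f \in Lfun mu 2%:E ->
  mu.-integrable `[x, y] (EFin \o f).
Proof.
move=> f2; apply: Lfun2_integrableS => //.
by rewrite lebesgue_measure_itv /=; case: ifP; rewrite ?ltry.
Qed.

Lemma Rintegral_itv_chasles f x y z : f \in Lfun mu 2%:E -> x <= y -> y <= z ->
  \int[mu]_(s in `[x, z]) f s = \int[mu]_(s in `[x, y]) f s + \int[mu]_(s in `[y, z]) f s.
Proof.
move=> f2 xy yz; rewrite -(@Rintegral_itv_obnd_cbnd _ y); last first.
  by apply: integrableS (Lfun2_integrable_itv y z f2) => //; exact: subset_itv_oc_cc.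
rewrite -(@Rintegral_itvB R f (BLeft x) (BRight z) y) ?bnd_simp//.
  by rewrite addrC subrK.
exact: Lfun2_integrable_itv.
Qed.

(** The increment formula is used twice. For (g, h) it shows that g agrees almost everywhere with a
    primitive D of h based at a Lebesgue point of g; for (f, g) it then makes f a primitive of the
    continuous function D. *)
Lemma sobolev_C1 f g h : continuous f ->
  f \in Lfun mu 2%:E -> g \in Lfun mu 2%:E -> h \in Lfun mu 2%:E ->
  weak_derivative f g -> weak_derivative g h ->
  exists D : R -> R, [/\ continuous D, forall x, is_derive x 1 f (D x),
    (\int[mu]_x (D x ^+ 2)%:E < +oo)%E &
    forall x y, x <= y -> D y - D x = \int[mu]_(s in `[x, y]) h s].
Proof.
move=> cf f2 g2 h2 fg gh.
have aeg : {ae mu, forall x, lebesgue_pt g x}.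
  exact: lebesgue_differentiation (Lfun2_locally_integrable g2).
(* Without any Lebesgue point the null set of exceptions would contain [0, 1]. *)
have [x0 gx0] : exists x0, lebesgue_pt g x0.
  apply: contrapT => H.
  have [N [mN N0 HN]] := aeg.
  have : (mu `[0%R, 1%R] <= mu N)%E.
    apply: le_measure; rewrite ?inE//.
    by move=> x _; apply: HN => /= gx; apply: H; exists x.
  by rewrite N0 lebesgue_measure_itv /= lte01 oppr0 adde0 lee_fin ler10.
pose I x := if x0 <= x then \int[mu]_(s in `[x0, x]) h s else - \int[mu]_(s in `[x, x0]) h s.
pose D x := g x0 + I x.
have Dsub x y : x <= y -> D y - D x = \int[mu]_(s in `[x, y]) h s.
  move=> xy; rewrite /D opprD addrACA subrr add0r /I.
  case: (leP x0 x) => x0x; case: (leP x0 y) => x0y.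
  - by rewrite (Rintegral_itv_chasles h2 x0x xy) addrAC subrr add0r.
  - by have := le_lt_trans xy x0y; rewrite ltNge x0x.
  - by rewrite opprK (Rintegral_itv_chasles h2 (ltW x0x) x0y) addrC.
  - by rewrite opprK (Rintegral_itv_chasles h2 xy (ltW x0y)) addrC addrK.
have gD : {ae mu, forall x, g x = D x}.
  apply: (@filterS _ _ (ae_filter_ringOfSetsType mu) _ _ _ aeg) => x gx.
  have [xx0|x0x|->] := ltgtP x x0.
  - rewrite /D /I leNgt xx0 /=.
    by rewrite -(weak_derivative_sub g2 h2 gh xx0 gx gx0) opprB addrC subrK.
  - rewrite /D /I (ltW x0x).
    by rewrite -(weak_derivative_sub g2 h2 gh x0x gx0 gx) addrC subrK.
  - by rewrite /D /I lexx set_itv1 Rintegral_set1 addr0.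
have cD : continuous D.
  move=> z.
  have zz : z - 1 < z + 1 by lra.
  have := parameterized_integral_continuous (ltW zz) (Lfun2_integrable_itv (z - 1) (z + 1) h2).
  move/(continuous_within_itvP _ zz) => -[/(_ z) cz _ _].
  have {}cz : {for z, continuous (fun x => \int[mu]_(t in `[z - 1, x]) h t)}.
    by apply: cz; rewrite in_itv /=; apply/andP; split; lra.
  have : {for z, continuous (fun x => D (z - 1) + \int[mu]_(t in `[z - 1, x]) h t)}.
    by apply: cvgD => //; exact: cvg_cst.
  rewrite /prop_for /continuous_at -Dsub; last by lra.
  rewrite [D (z - 1) + _]addrC subrK; apply: cvg_trans; apply: near_eq_cvg.
  near=> x; rewrite /= -Dsub; last first.
    by apply: ltW; near: x; apply: lt_nbhsr; lra.
  by rewrite addrC subrK.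
have mD : measurable_fun setT D by exact: continuous_measurable_fun.
exists D; split => //.
- move=> z.
  (* Continuity makes every point a Lebesgue point of f, so its increment formula holds everywhere
     and not just almost everywhere. *)
  have lf x : lebesgue_pt f x.
    have oT : open_nbhs x [set: R] by split => //; exact: openT.
    exact (@continuous_lebesgue_pt R f x setT oT measurableT (Lfun2_measurable f2) (cf x)).
  have Gsub x y : x < y -> f y - f x = \int[mu]_(s in `[x, y]) D s.
    move=> xy; rewrite (weak_derivative_sub f2 g2 fg xy).
    + rewrite /Rintegral; congr fine; apply: ae_eq_integral => //.
      * by apply/measurable_EFinP; apply: measurable_funTS; exact: Lfun2_measurable.
      * by apply/measurable_EFinP; apply: measurable_funTS.
      * by apply: (@filterS _ _ (ae_filter_ringOfSetsType mu) _ _ _ gD) => s /= ->.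
    + exact: lf.
    + exact: lf.
  have iD : mu.-integrable `[z - 1, z + 1] (EFin \o D).
    apply: continuous_compact_integrable; first exact: segment_compact.
    exact: continuous_subspaceT.
  have [||dF F'] := @continuous_FTC1_closed R D (z - 1) z (z + 1) _ iD _ (cD z); [lra|lra|].
  have dF1 : is_derive z 1 (fun x => \int[mu]_(t in [set` `[z - 1, x]]) D t) (D z).
    by apply: DeriveDef => //; rewrite -derive1E F'.
  have : is_derive z 1 (fun x => f (z - 1) + \int[mu]_(t in [set` `[z - 1, x]]) D t) (D z).
    by rewrite -[X in is_derive _ _ _ X]add0r; apply: is_deriveD; exact: is_derive_cst.
  apply: near_eq_is_derive.
  near=> x; rewrite -Gsub; last by near: x; apply: lt_nbhsr; lra.
  by rewrite addrC subrK.
- have /integrable_lty goo := Lfun2_integrable_sqr g2; apply: le_lt_trans (goo _) => //.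
  rewrite le_eqVlt; apply/orP; left; apply/eqP.
  apply: ae_eq_integral => //.
  + by apply/measurable_EFinP; apply: measurable_funX.
  + by apply/measurable_EFinP; apply: measurable_funX; exact: Lfun2_measurable.
  + by apply: (@filterS _ _ (ae_filter_ringOfSetsType mu) _ _ _ gD) => s /= ->.
Unshelve. all: by end_near. Qed.

End sobolev_C1.

(** * A pointwise bound on the Hilbert transform *)

Section hilbert_bound.
Context {R : realType}.
Local Notation mu := (@lebesgue_measure R).
Implicit Types (f g h D P : R -> R) (x y s e c : R).

(* When the limit does not exist, [lim] is the default value 0, so that its
   existence need not be assumed. *)
Lemma normr_lim_le (f : R -> R) x c : 0 <= c ->
  (\forall e \near x^'+, `|f e| <= c) -> `|lim (f @ x^'+)| <= c.
Proof.
move=> c0 fc; have [cf|/dvgP ->] := pselect (cvg (f @ x^'+)).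
  have -> : `|lim (f @ x^'+)| = lim ((fun e => `|f e|) @ x^'+).
    by apply/esym/cvg_lim; [exact: Rhausdorff|exact: cvg_norm].
  by apply: limr_le => //; apply/cvg_ex; exists `|lim (f @ x^'+)|; exact: cvg_norm.
by rewrite normr0.
Qed.

(* The primitive - ln ((x - y)^2) / 2 is valid on both sides of the singularity. *)
Lemma integral_inv_sub x (a b : R) : a < b -> x \notin `[a, b] ->
  \int[mu]_(y in `[a, b]) ((x - y)^-1) = (ln ((x - a) ^+ 2) - ln ((x - b) ^+ 2)) / 2.
Proof.
move=> ab xab.
pose F y : R := - (ln ((x - y) ^+ 2) / 2).
have xy y : y \in `[a, b] -> x - y != 0.
  by move=> yab; apply: contra xab; rewrite subr_eq0 => /eqP ->.
have dF y : y \in `[a, b] -> is_derive y 1 F (x - y)^-1.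
  move=> /xy xy0; have p0 : 0 < (x - y) ^+ 2 by rewrite exprn_even_gt0.
  have := is_derive1_ln p0 => H.
  have H2 : is_derive y 1 (fun y => (x - y) ^+ 2) (- (2 * (x - y))).
    have H3 : is_derive y 1 (fun y => x - y) (-1).
      by rewrite -[X in is_derive _ _ _ X]sub0r; apply: is_deriveB.
    apply: (is_derive_eq (is_deriveX 2 H3)).
    by rewrite /GRing.scale /= mulrN1.
  have H4 := @is_derive1_comp _ (@ln R) (fun y => (x - y) ^+ 2) y _ _ H H2.
  have -> : (x - y)^-1 = - (2^-1 *: (((x - y) ^+ 2)^-1 * - (2 * (x - y)))).
    by rewrite /GRing.scale /=; field.
  have -> : F = - (2^-1 *: ((@ln R) \o (fun y => (x - y) ^+ 2))).
    by apply/funext => t; rewrite /F mulrC.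
  by apply: is_deriveN; apply: is_deriveZ.
have cont y : y \in `[a, b] -> {for y, continuous (fun y => (x - y)^-1)}.
  move=> /xy xy0; apply: cvgV => //.
  by apply: cvgB; [exact: cvg_cst|exact: cvg_id].
have cF y : y \in `[a, b] -> {for y, continuous F}.
  move=> yab; apply/differentiable_continuous/derivable1_diffP.
  by have [] := dF _ yab.
rewrite /Rintegral (@continuous_FTC2 _ _ F) //=.
- by rewrite /F; field.
- apply/(continuous_within_itvP _ ab); split.
  + by move=> y yab; apply: cont; exact: subset_itv_oo_cc.
  + by apply: cvg_at_right_filter; apply: cont; rewrite in_itv /= lexx ltW.
  + by apply: cvg_at_left_filter; apply: cont; rewrite in_itv /= lexx ltW.
- split.
  + by move=> y yab; have [] := dF _ (subset_itv_oo_cc yab).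
  + by apply: cvg_at_right_filter; apply: cF; rewrite in_itv /= lexx ltW.
  + by apply: cvg_at_left_filter; apply: cF; rewrite in_itv /= lexx ltW.
- by move=> y yab; rewrite derive1E; have [_ ->] := dF _ (subset_itv_oo_cc yab).
Qed.

(* Up to constants the kernel dominates both 1/|x - y| on |x - y| > 1 and the
   indicator function of |x - y| <= 1, which is how the singular part of the
   Hilbert transform of a C^1 function is bounded. *)
Definition potential P x : \bar R := \int[mu]_y (P y / (1 + `|x - y|))%:E.

Lemma potential_ge0 P x : (forall y, 0 <= P y) -> (0 <= potential P x)%E.
Proof.
by move=> P0; apply: integral_ge0 => y _; rewrite lee_fin divr_ge0// addr_ge0.
Qed.

Lemma measurable_potential_integrand P x : measurable_fun setT P ->
  measurable_fun setT (fun y => P y / (1 + `|x - y|)).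
Proof.
move=> mP; apply: measurable_funM => //.
apply: continuous_measurable_fun => y; apply: cvgV.
  by rewrite gt_eqF// ltr_pwDl.
apply: cvgD; first exact: cvg_cst.
by apply: cvg_norm; apply: cvgB; [exact: cvg_cst|exact: cvg_id].
Qed.

Lemma integral_le_potential P x c (A : set R) (f : R -> R) :
  (forall y, 0 <= P y) -> measurable_fun setT P -> 0 <= c ->
  measurable A -> measurable_fun A f -> (forall y, A y -> 0 <= f y) ->
  (forall y, A y -> f y <= c * (P y / (1 + `|x - y|))) ->
  (\int[mu]_(y in A) (f y)%:E <= c%:E * potential P x)%E.
Proof.
move=> P0 mP c0 mA mf f0 fP.
have mk := measurable_potential_integrand x mP.
have k0 y : 0 <= P y / (1 + `|x - y|) by rewrite divr_ge0// addr_ge0.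
rewrite /potential -ge0_integralZl//; last 2 first.
  exact/measurable_EFinP.
  by move=> y _; rewrite lee_fin.
apply: (@le_trans _ _ (\int[mu]_(y in A) (c%:E * (P y / (1 + `|x - y|))%:E)%E)%E).
  apply: ge0_le_integral => //.
  - exact/measurable_EFinP.
  - by apply/measurable_EFinP; apply: measurable_funM => //; exact: measurable_funTS.
apply: ge0_subset_integral => //.
- by apply/measurable_EFinP; apply: measurable_funM.
- by move=> y _; rewrite -EFinM lee_fin mulr_ge0.
Qed.


End hilbert_bound.

(** * A bound on truncated Hilbert transforms, uniform in the truncation *)

Section truncated_hilbert.
Context {R : realType}.
Local Notation mu := (@lebesgue_measure R).
Implicit Types (f g h D P G : R -> R) (x y s e c : R).

Lemma continuous_integrable_itv f x y : {within `[x, y], continuous f} ->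
  mu.-integrable `[x, y] (EFin \o f).
Proof. by move=> cf; apply: continuous_compact_integrable => //; exact: segment_compact. Qed.

Lemma Rintegral_cst_itv c x y : x <= y -> \int[mu]_(s in `[x, y]) cst c s = c * (y - x).
Proof.
move=> xy; transitivity (c * fine (mu `[x, y])); first exact: Rintegral_cst.
rewrite lebesgue_measure_itv /= lte_fin; case: (ltgtP x y) xy => [_ _|//|-> _].
  by rewrite -EFinB.
by rewrite subrr.
Qed.

(** A local Sobolev inequality: |D s| <= |D t| + int |h| for every t in the window, and averaging
    over t, in a window of length 2, gives |D s| <= (int |D|) / 2 + int |h|. *)
Lemma normr_le_integral_itv D h x s : continuous D -> h \in Lfun mu 2%:E ->
  (forall a b, a <= b -> D b - D a = \int[mu]_(y in `[a, b]) h y) ->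
  s \in `[x - 1, x + 1] ->
  (`|D s|%:E <= \int[mu]_(y in `[(x - 1)%R, (x + 1)%R]) (`|D y| + `|h y|)%:E)%E.
Proof.
move=> cD h2 Dsub sI.
have iD : mu.-integrable `[x - 1, x + 1] (EFin \o (fun y => `|D y|)).
  by apply: integrable_norm; apply: continuous_integrable_itv; exact: continuous_subspaceT.
have ih : mu.-integrable `[x - 1, x + 1] (EFin \o (fun y => `|h y|)).
  by apply: integrable_norm; exact: Lfun2_integrable_itv.
set J := \int[mu]_(y in `[x - 1, x + 1]) `|h y|.
have DJ a b : a \in `[x - 1, x + 1] -> b \in `[x - 1, x + 1] -> a <= b -> `|D b - D a| <= J.
  rewrite !in_itv /= => /andP[xa ax] /andP[xb bx] ab.
  have sub : `[a, b] `<=` `[x - 1, x + 1].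
    by apply: subset_itv; rewrite bnd_simp.
  have iab := Lfun2_integrable_itv a b h2.
  rewrite (Dsub _ _ ab); apply: le_trans (le_normr_Rintegral _ iab) _ => //.
  rewrite /J /Rintegral fine_le//.
  - by apply: integrable_fin_num => //; exact: integrable_norm.
  - exact: integrable_fin_num.
  - apply: ge0_subset_integral => //.
    by have /measurable_int := ih.
have Ds t : t \in `[x - 1, x + 1] -> `|D s| <= `|D t| + J.
  move=> tI; rewrite -lerBlDl; apply: le_trans (lerB_dist _ _) _.
  have [st|ts] := leP s t; first by rewrite distrC DJ.
  by rewrite DJ// ltW.
have icst (r : R) : mu.-integrable `[x - 1, x + 1] (EFin \o cst r).
  by apply: continuous_integrable_itv; apply: continuous_subspaceT => ?; exact: cvg_cst.
have H : 2 * `|D s| <= \int[mu]_(y in `[x - 1, x + 1]) `|D y| + 2 * J.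
  have <- : \int[mu]_(y in `[x - 1, x + 1]) (cst `|D s| y) = 2 * `|D s|.
    rewrite Rintegral_cst_itv; [ring|lra].
  have <- : \int[mu]_(y in `[x - 1, x + 1]) (cst J y) = 2 * J.
    rewrite Rintegral_cst_itv; [ring|lra].
  rewrite -RintegralD//; apply: le_Rintegral => //.
    exact: (@integrableD _ _ _ mu _ _ _ _ iD (icst J)).
have D0 : 0 <= \int[mu]_(y in `[x - 1, x + 1]) `|D y| by exact: Rintegral_ge0.
have iDh : mu.-integrable `[x - 1, x + 1] (EFin \o (fun y => `|D y| + `|h y|)).
  exact: (@integrableD _ _ _ mu _ _ _ _ iD ih).
rewrite -[leRHS]fineK; last exact: integrable_fin_num.
rewrite lee_fin -/(Rintegral mu _ _) RintegralD// -/J.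
by move: H D0; move: (\int[mu]_(y in _) `|D y|) => u; lra.
Qed.

(** For t > e one has 1 + t <= (1 + 1/e) t. At e = 1 the factor is 2, which yields the far part of
    the Hilbert transform; for small e the bound only serves to prove integrability. *)
Lemma div_le_weighted (p q t e : R) : 0 < e -> e < t -> 0 <= p -> p <= q ->
  p / t <= (1 + e^-1) * (q / (1 + t)).
Proof.
move=> e0 et p0 pq; have t0 : 0 < t by exact: lt_trans et.
have H : 1 <= e^-1 * t by rewrite ler_pdivlMl// mulr1 ltW.
rewrite ler_pdivrMr//.
have -> : (1 + e^-1) * (q / (1 + t)) * t = q * (t + e^-1 * t) / (1 + t) by ring.
rewrite ler_pdivlMr ?addr_gt0//; apply: ler_pM => //; first by rewrite addr_ge0// ltW.
by rewrite addrC lerD2l.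
Qed.

(** The regularity of an H^2 function in classical form: the second derivative [h] is seen only
    through the increments of [D]. *)
Variant is_C1_jet G D h : Prop := IsC1Jet of
  continuous D & (forall x, is_derive x 1 G (D x)) & h \in Lfun mu 2%:E &
  (forall a b, a <= b -> D b - D a = \int[mu]_(y in `[a, b]) h y).

Lemma is_C1_jet_continuous G D h : is_C1_jet G D h -> continuous G.
Proof.
move=> [_ dG _ _] x; apply/differentiable_continuous/derivable1_diffP.
by have [] := dG x.
Qed.

Section truncated.
Context (G D h : R -> R) (GDh : is_C1_jet G D h).
Let P y : R := `|G y| + `|D y| + `|h y|.
Context (x b : R) (Pb : potential P x = b%:E).

Let P0 y : 0 <= P y. Proof. by rewrite !addr_ge0. Qed.

Let cG : continuous G := is_C1_jet_continuous GDh.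

Let mP : measurable_fun setT P.
Proof.
have [cD _ h2 _] := GDh.
apply: measurable_funD; first apply: measurable_funD.
- by apply: measurableT_comp => //; exact: continuous_measurable_fun.
- by apply: measurableT_comp => //; exact: continuous_measurable_fun.
- by apply: measurableT_comp => //; exact: Lfun2_measurable.
Qed.

Let b0 : 0 <= b.
Proof. by rewrite -lee_fin -Pb; exact: potential_ge0. Qed.

(** On |x - y| <= 1 one has 1 <= 2 / (1 + |x - y|), so the local Sobolev bound is at most twice the
    potential. *)
Let D_le s : s \in `[x - 1, x + 1] -> `|D s| <= 2 * b.
Proof.
have [cD dG h2 Dsub] := GDh.
move=> sI; rewrite -lee_fin; apply: le_trans (normr_le_integral_itv cD h2 Dsub sI) _.
rewrite EFinM -Pb; apply: integral_le_potential => //.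
- apply: measurable_funTS; apply: measurable_funD.
  + by apply: measurableT_comp => //; exact: continuous_measurable_fun.
  + by apply: measurableT_comp => //; exact: Lfun2_measurable.
move=> y; rewrite /= in_itv /= => /andP[y1 y2].
have xy : `|x - y| <= 1 by rewrite ler_norml; apply/andP; split; lra.
rewrite mulrA ler_pdivlMr ?ltr_pwDl//.
rewrite [leRHS]mulrC ler_pM ?addr_ge0//; last by lra.
by rewrite /P -addrA lerDr.
Qed.

Let diff_quot_le y : y \in `[x - 1, x + 1] -> `|(G y - G x) / (x - y)| <= 2 * b.
Proof.
have [cD dG h2 Dsub] := GDh.
rewrite in_itv /= => /andP[y1 y2].
suff H : `|G y - G x| <= 2 * b * `|x - y|.
  have [->|xy] := eqVneq x y; first by rewrite subrr mul0r normr0 mulr_ge0.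
  by rewrite normrM normfV ler_pdivrMr// normr_gt0 subr_eq0.
have cGi u v : {within `[u, v], continuous G} by exact: continuous_subspaceT.
have [xy|/ltW yx] := leP x y.
  have [c] := MVT_segment xy (fun z _ => dG z) (cGi x y).
  rewrite in_itv /= => /andP[xc cy] ->; rewrite normrM (distrC x y) ler_wpM2r//.
  by apply: D_le; rewrite in_itv /=; apply/andP; split; lra.
have [c] := MVT_segment yx (fun z _ => dG z) (cGi y x).
rewrite in_itv /= => /andP[yc cx]; rewrite distrC => ->; rewrite normrM ler_wpM2r//.
by apply: D_le; rewrite in_itv /=; apply/andP; split; lra.
Qed.

(** Subtracting G x from G y leaves a difference quotient bounded by 2b, on an interval of length at
    most 1. The subtracted term is integrated exactly, because its logarithmic divergence has to
    cancel between the two sides of x. *)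
Let near_part u v : x - 1 <= u -> u < v -> v <= x + 1 -> v - u <= 1 -> x \notin `[u, v] ->
  `|\int[mu]_(y in `[u, v]) (G y / (x - y)) -
    G x * ((ln ((x - u) ^+ 2) - ln ((x - v) ^+ 2)) / 2)| <= 2 * b.
Proof.
move=> xu uv vx vu1 xuv; rewrite -integral_inv_sub//.
have ci : {within `[u, v], continuous (fun y => (x - y)^-1)}.
  apply/continuous_in_subspaceT => y; rewrite inE /= => yuv.
  apply: cvgV; first by apply: contra xuv; rewrite subr_eq0 => /eqP ->.
  by apply: cvgB; [exact: cvg_cst|exact: cvg_id].
have i1 := continuous_integrable_itv ci.
have c2 : {within `[u, v], continuous (fun y => G y / (x - y))}.
  by move=> y; apply: cvgM; [exact: (continuous_subspaceT cG)|exact: ci].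
have i2 := continuous_integrable_itv c2.
have i3 : mu.-integrable `[u, v] (EFin \o (fun y => G x * (x - y)^-1)).
  exact: (@integrableZl _ _ _ mu _ _ (G x) _ i1).
rewrite -RintegralZl// -RintegralB//.
have i4 : mu.-integrable `[u, v] (EFin \o (fun y => G y / (x - y) - G x * (x - y)^-1)).
  exact: (@integrableB _ _ _ mu _ _ _ _ i2 i3).
apply: le_trans (le_normr_Rintegral _ i4) _ => //.
have icst : mu.-integrable `[u, v] (EFin \o cst (2 * b)).
  by apply: continuous_integrable_itv; apply: continuous_subspaceT => ?; exact: cvg_cst.
apply: (@le_trans _ _ (\int[mu]_(y in `[u, v]) cst (2 * b) y)).
  apply: le_Rintegral => //; first exact: integrable_norm.
  move=> y /=; rewrite in_itv /= => /andP[uy yv]; rewrite -mulrBl diff_quot_le//.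
  by rewrite in_itv /=; apply/andP; split; lra.
by rewrite (Rintegral_cst_itv _ (ltW uv)) ler_piMr// mulr_ge0.
Qed.

(** The far part |x - y| > 1 and the two near parts contribute 2b each; the terms G x ln(e^2) / 2 of
    the near parts have opposite signs and cancel. *)
Lemma truncated_hilbert_le e : 0 < e -> e < 1 ->
  `|\int[mu]_(y in [set y | e < `|x - y|]) (G y / (x - y))| <= 6 * b.
Proof.
move=> e0 e1; pose phi y := G y / (x - y).
pose k y := P y / (1 + `|x - y|).
pose N1 := `[x - 1, x - e[%classic; pose N2 := `]x + e, x + 1]%classic.
pose F := ~` `[x - 1, x + 1]%classic.
have AE : [set y | e < `|x - y|] = F `|` (N1 `|` N2).
  apply/seteqP; split => y /=.
    rewrite ltr_normr => exy; rewrite /F /N1 /N2 /= !in_itv /=.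
    have [yI|yI] := boolP (x - 1 <= y <= x + 1); last by left; exact/negP.
    move: yI => /andP[y1 y2]; case/orP: exy => ?; right; [left|right]; apply/andP; split; lra.
  move=> [yI|[|]]; rewrite /N1 /N2 /= ?in_itv /=.
  - apply: lt_trans e1 _; rewrite ltNge; apply/negP => xy; apply: yI.
    by move: xy; rewrite /= in_itv /= ler_norml => /andP[? ?]; apply/andP; split; lra.
  - by move=> /andP[? ?]; rewrite ltr_normr; apply/orP; left; lra.
  - by move=> /andP[? ?]; rewrite ltr_normr; apply/orP; right; lra.
have mF : measurable F by apply: measurableC.
have mN1 : measurable N1 by exact: measurable_itv.
have mN2 : measurable N2 by exact: measurable_itv.
have mN : measurable (N1 `|` N2) by exact: measurableU.
have mA : measurable (F `|` (N1 `|` N2)) by exact: measurableU.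
have mphi : measurable_fun (F `|` (N1 `|` N2)) phi.
  (* Off the excised interval 1/(x - y) agrees with (x - y) / max(e^2, (x - y)^2), which is
     continuous on the whole line. *)
  apply: (@eq_measurable_fun _ _ _ _ _
      (fun y => G y * ((x - y) / Num.max (e ^+ 2) ((x - y) ^+ 2)))).
    rewrite -AE => y; rewrite inE /= => exy; rewrite /phi max_r; last first.
      by rewrite -[leRHS]real_normK ?num_real// ler_sqr ?nnegrE// ltW.
    have xy0 : x - y != 0 by rewrite -normr_gt0; exact: lt_trans exy.
    by field.
  apply: measurable_funTS; apply: continuous_measurable_fun => y; apply: cvgM; first exact: cG.
  have cx : {for y, continuous (fun y => x - y)}.
    by apply: cvgB; [exact: cvg_cst|exact: cvg_id].
  apply: cvgM => //; apply: cvgV.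
    by rewrite gt_eqF// lt_max exprn_gt0.
  apply: (@continuous_max _ _ (cst (e ^+ 2)) (fun y => (x - y) ^+ 2)); first exact: cvg_cst.
  exact: (cvgM cx cx).
have mk : measurable_fun setT k by exact: measurable_potential_integrand.
have k0 y : 0 <= k y by rewrite divr_ge0// addr_ge0.
have ik : mu.-integrable setT (EFin \o k).
  apply/integrableP; split; first exact/measurable_EFinP.
  suff -> : (\int[mu]_y `|(EFin \o k) y|)%E = potential P x by rewrite Pb ltry.
  by apply: eq_integral => y _ /=; rewrite ger0_norm.
have iA : mu.-integrable (F `|` (N1 `|` N2)) (EFin \o phi).
  (* The factor [1 + e^-1] is not uniform in e, but only integrability for the given e is sought. *)
  apply: (@le_integrable _ _ _ mu _ mA _ (EFin \o (fun y => (1 + e^-1) * k y))).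
  - exact/measurable_EFinP.
  - rewrite -AE => y /= exy; rewrite lee_fin [leRHS]ger0_norm; last first.
      by rewrite mulr_ge0// addr_ge0// invr_ge0 ltW.
    rewrite /phi /k normrM normfV; apply: div_le_weighted => //.
    by rewrite /P -addrA lerDl addr_ge0.
  - apply: (@integrableS _ _ _ mu setT) => //.
    exact: (@integrableZl _ _ _ mu _ _ (1 + e^-1) _ ik).
have iN : mu.-integrable (N1 `|` N2) (EFin \o phi).
  by apply: integrableS iA => //; exact: subsetUr.
have iF : mu.-integrable F (EFin \o phi).
  by apply: integrableS iA => //; exact: subsetUl.
have iN1 : mu.-integrable N1 (EFin \o phi).
  by apply: integrableS iN => //; exact: subsetUl.
have iN2 : mu.-integrable N2 (EFin \o phi).
  by apply: integrableS iN => //; exact: subsetUr.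
have d1 : [disjoint F & N1 `|` N2].
  apply/disj_setPS => y [/= yI yN]; apply: yI; move: yN.
  by rewrite /N1 /N2 /= !in_itv /= => -[] /andP[? ?]; apply/andP; split; lra.
have d2 : [disjoint N1 & N2].
  by apply/disj_setPS => y []; rewrite /N1 /N2 /= !in_itv /= => /andP[? ?] /andP[? ?]; lra.
rewrite AE (@Rintegral_setU _ _ _ mu F (N1 `|` N2) phi); [|exact: mF|exact: mN|exact: iA|exact: d1].
rewrite (@Rintegral_setU _ _ _ mu N1 N2 phi); [|exact: mN1|exact: mN2|exact: iN|exact: d2].
rewrite /N1 /N2 (Rintegral_itv_bndo_bndc iN1) (Rintegral_itv_obnd_cbnd iN2).
have HF : `|\int[mu]_(y in F) phi y| <= 2 * b.
  rewrite -lee_fin EFin_normr_Rintegral//.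
  have /measurable_int miF := iF.
  apply: (le_trans (le_abse_integral mu mF miF)).
  rewrite EFinM -Pb; apply: integral_le_potential => //.
  - by apply: measurableT_comp => //; exact/measurable_EFinP.
  - move=> y yF; have t1 : 1 < `|x - y|.
      rewrite ltNge; apply/negP => xy; apply: yF.
      by move: xy; rewrite /= in_itv /= ler_norml => /andP[? ?]; apply/andP; split; lra.
    rewrite /phi normrM normfV; have -> : 2 = 1 + 1^-1 :> R by rewrite invr1.
    by apply: div_le_weighted => //; rewrite /P -addrA lerDl addr_ge0.
have H1 : `|\int[mu]_(y in `[x - 1, x - e]) phi y - G x * ((0 - ln (e ^+ 2)) / 2)| <= 2 * b.
  have := @near_part (x - 1) (x - e).
  rewrite !subKr expr1n ln1; apply; [lra|lra|lra|lra|].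
  by rewrite in_itv /= negb_and -!ltNge; apply/orP; right; lra.
have H2 : `|\int[mu]_(y in `[x + e, x + 1]) phi y - G x * ((ln (e ^+ 2) - 0) / 2)| <= 2 * b.
  have := @near_part (x + e) (x + 1).
  have -> : x - (x + e) = - e by ring.
  have -> : x - (x + 1) = - 1 by ring.
  rewrite !sqrrN expr1n ln1; apply; [lra|lra|lra|lra|].
  by rewrite in_itv /= negb_and -!ltNge; apply/orP; left; lra.
move: HF H1 H2; move: (\int[mu]_(y in F) _) (\int[mu]_(y in `[x - 1, x - e]) _) (\int[mu]_(y in `[x + e, x + 1]) _).
move=> u v w; rewrite !ler_norml => /andP[? ?] /andP[? ?] /andP[? ?].
by apply/andP; split; lra.
Qed.

End truncated.
End truncated_hilbert.

(** The truncated bound is uniform in e < 1 and passes to the limit; the factor 1/pi <= 1 is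
    dropped. An infinite potential makes the bound trivial. *)
Lemma hilbert_le {R : realType} (G D h : R -> R) (x : R) : is_C1_jet G D h ->
  (`|hilbert G x|%:E <=
   6%:E * potential (fun y => `|G y| + `|D y| + `|h y|)%R x)%E.
Proof.
move=> GDh.
have := @potential_ge0 _ (fun y => `|G y| + `|D y| + `|h y|) x.
case Pb : potential => [b| |] /(_ _)-b0.
- have {}b0 : 0 <= b by rewrite -lee_fin; apply: b0 => y; rewrite !addr_ge0.
  rewrite lee_fin normrM ger0_norm; last by rewrite invr_ge0 pi_ge0.
  rewrite -[leRHS]mul1r ler_pM ?invr_ge0 ?pi_ge0//.
    by rewrite invf_le1 ?pi_gt0//; apply: le_trans (pi_ge2 R); lra.
  apply: normr_lim_le; first by rewrite mulr_ge0.
  near=> e; apply: (truncated_hilbert_le GDh Pb).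
    by near: e; exact: nbhs_right_gt.
  by near: e; apply: nbhs_right_lt; exact: ltr01.
- by rewrite gt0_muley ?lte_fin// leey.
- have : (0 <= -oo :> \bar R)%E by apply: b0 => y; rewrite !addr_ge0.
  by rewrite leNgt ltNy0.
Unshelve. all: by end_near. Qed.

(** * A weighted L^1 bound *)

Section weight.
Context {R : realType}.
Local Notation mu := (@lebesgue_measure R).
Implicit Types (x y c : R) (P : R -> R).

(** The weight (1+|x|)^(-4/5), the kernel (1+|x|)^(-1) and the integrable (1+|x|)^(-6/5) become the
    powers 4, 5 and 6 of one function, so that the inequalities between them are polynomial. *)
Definition weight x : R := (1 + `|x|) `^ (- 5^-1).

Lemma weight_gt0 x : 0 < weight x.
Proof. by rewrite powR_gt0// ltr_pwDl. Qed.

Lemma weight_ge0 x : 0 <= weight x. Proof. exact/ltW/weight_gt0. Qed.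

Lemma weightX5 x : weight x ^+ 5 = (1 + `|x|)^-1.
Proof.
rewrite -powR_mulrn ?powR_ge0// -powRrM mulNr mulVf//.
by rewrite powR_inv1// addr_ge0.
Qed.

Lemma weight_le1 x : weight x <= 1.
Proof.
rewrite -(@ler_pXn2r _ 5)// ?nnegrE ?weight_ge0// expr1n weightX5.
by rewrite invf_le1 ?lerDl// ltr_pwDl.
Qed.

Lemma weightN x : weight (- x) = weight x. Proof. by rewrite /weight normrN. Qed.

Lemma continuous_powRr (a c : R) : 0 < c -> {for c, continuous (fun x => x `^ a)}.
Proof.
move=> c0; apply/differentiable_continuous/derivable1_diffP.
by have [] := is_derive1_powR a c0.
Qed.

Lemma continuous_weight : continuous weight.
Proof.
move=> x; apply: (@continuous_comp _ _ _ (fun x => 1 + `|x|) (fun x => x `^ _)).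
  by apply: cvgD; [exact: cvg_cst|exact: norm_continuous].
by apply: continuous_powRr; rewrite ltr_pwDl.
Qed.

Lemma continuous_weightX n : continuous (fun x => weight x ^+ n).
Proof.
move=> x; apply: (@continuous_comp _ _ _ weight (fun y : R => y ^+ n)).
  exact: continuous_weight.
exact: exprn_continuous.
Qed.

Lemma measurable_weightX n : measurable_fun setT (fun x => weight x ^+ n).
Proof. by apply: continuous_measurable_fun; exact: continuous_weightX. Qed.

Lemma powRN_cvgy (r : R) : 0 < r -> x `^ (- r) @[x --> +oo] --> (0 : R).
Proof.
move=> r0; apply/cvgrPdist_le => e e0; near=> x.
have x0 : 0 < x by near: x; exact: nbhs_pinfty_gt.
rewrite sub0r normrN ger0_norm ?powR_ge0// powRN.
rewrite -[e]invrK lef_pV2 ?posrE ?invr_gt0 ?powR_gt0//.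
have -> : e^-1 = (e^-1 `^ r^-1) `^ r.
  by rewrite -powRrM mulVf ?gt_eqF// powRr1// invr_ge0 ltW.
have H : e^-1 `^ r^-1 <= x by near: x; exact: nbhs_pinfty_ge.
by rewrite ge0_ler_powR// ?nnegrE ?powR_ge0// ltW.
Unshelve. all: by end_near. Qed.

(** Twice the integral over the half-line, where -5 (1 + x)^(-1/5) is a primitive. *)
Lemma integral_weightX6 : (\int[mu]_x (weight x ^+ 6)%:E = 10%:E)%E.
Proof.
rewrite ge0_symfun_integralT; last 3 first.
- by move=> x; rewrite exprn_ge0// weight_ge0.
- exact: continuous_weightX.
- by move=> x /=; rewrite weightN.
rewrite -set_itvcy.
pose F x : R := - (5 * (1 + x) `^ (- 5^-1)).
have dF x : 0 <= x -> is_derive x 1 F (weight x ^+ 6).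
  move=> x0; have x1 : 0 < 1 + x by rewrite ltr_pwDl.
  have H1 : is_derive x 1 (fun x : R => 1 + x) 1.
    by rewrite -[X in is_derive _ _ _ X]add0r; apply: is_deriveD.
  have H2 := @is_derive1_comp _ (fun y => y `^ (- 5^-1)) _ x _ _ (is_derive1_powR _ x1) H1.
  have H3 := is_deriveN (is_deriveZ 5 H2).
  apply: (is_derive_eq H3).
  rewrite exprS weightX5 /weight ger0_norm// /GRing.scale /= mulr1.
  rewrite powRB; last by rewrite (gt_eqF x1) implybT.
  rewrite powRr1 ?ltW//; field.
  by rewrite gt_eqF.
rewrite (@ge0_continuous_FTC2y _ _ F 0 0).
- by rewrite /F addr0 powR1 mulr1 -EFinB -EFinM; congr EFin; ring.
- by move=> x _; rewrite exprn_ge0// weight_ge0.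
- by apply: continuous_subspaceT; exact: continuous_weightX.
- rewrite -oppr0; apply: cvgN; rewrite -(mulr0 5); apply: cvgMl_tmp.
  by apply: (@cvg_comp _ _ _ (fun x : R => 1 + x) (fun x => x `^ _)); [exact: cvg_addrl|exact: powRN_cvgy].
- by move=> x /ltW/dF[].
- apply: cvg_at_right_filter.
  by apply/differentiable_continuous/derivable1_diffP; have [] := dF 0 (lexx 0).
- by move=> x; rewrite in_itv /= andbT => /ltW/dF[_]; rewrite derive1E.
Qed.

Lemma integral_weightX6_shift c : (\int[mu]_x (weight (x - c) ^+ 6)%:E = 10%:E)%E.
Proof.
have dF x : is_derive x 1 (fun x : R => x - c) 1.
  by rewrite -[X in is_derive _ _ _ X]subr0; apply: is_deriveB.
have F'E : derive1 (fun x : R => x - c) = cst 1.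
  by apply/funext => x; rewrite derive1E; have [_ ->] := dF x.
rewrite -integral_weightX6.
rewrite (@increasing_ge0_integration_by_substitutionT _ (fun x => x - c) (fun x => weight x ^+ 6)).
- by apply: eq_integral => x _; rewrite F'E /GRing.mul/= mulr1.
- by move=> x y; rewrite ltrD2r.
- by rewrite F'E; exact: cst_continuous.
- by rewrite F'E; exact: is_cvg_cst.
- by rewrite F'E; exact: is_cvg_cst.
- by move=> x; have [] := dF x.
- exact: cvg_addrr_Ny.
- exact: cvg_addrr.
- exact: continuous_weightX.
- by move=> x; rewrite exprn_ge0// weight_ge0.
Qed.

End weight.

(** * Integrability of the potential against the weight *)

Section weighted_potential.
Context {R : realType}.
Local Notation mu := (@lebesgue_measure R).
Local Notation MR := (measurableTypeR R).
Implicit Types (x y c : R) (P : R -> R).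

(* With a = weight x and b = weight (x - y), the left-hand side is the integrand
   p(y) (1+|x|)^(-4/5) (1+|x-y|)^(-1), and the sixth powers are integrable. *)
Lemma weighted_young (p a b : R) : 0 <= p -> 0 <= a -> 0 <= b ->
  a ^+ 4 * (p * b ^+ 5) <= p ^+ 2 * a ^+ 6 + p ^+ 2 * b ^+ 6 + a ^+ 6 * b ^+ 6.
Proof.
move=> p0 a0 b0.
have H1 : (p * a * b ^+ 2) * (a ^+ 3 * b ^+ 3) <= (p * a * b ^+ 2) ^+ 2 + (a ^+ 3 * b ^+ 3) ^+ 2.
  by move: (p * a * b ^+ 2) (a ^+ 3 * b ^+ 3) => u v; nra.
have H2 : a ^+ 2 * b ^+ 4 <= a ^+ 6 + b ^+ 6.
  have [ab|/ltW ba] := leP a b.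
    apply: (@le_trans _ _ (b ^+ 2 * b ^+ 4)); last by rewrite -exprD lerDr exprn_ge0.
    by rewrite ler_wpM2r ?exprn_ge0// ler_sqr.
  apply: (@le_trans _ _ (a ^+ 2 * a ^+ 4)); last by rewrite -exprD lerDl exprn_ge0.
  by rewrite ler_wpM2l ?exprn_ge0// lerXn2r.
have H3 : p ^+ 2 * (a ^+ 2 * b ^+ 4) <= p ^+ 2 * (a ^+ 6 + b ^+ 6).
  by rewrite ler_wpM2l ?exprn_ge0.
have -> : a ^+ 4 * (p * b ^+ 5) = (p * a * b ^+ 2) * (a ^+ 3 * b ^+ 3) by ring.
apply: (le_trans H1); rewrite -mulrDr.
have -> : (p * a * b ^+ 2) ^+ 2 = p ^+ 2 * (a ^+ 2 * b ^+ 4) by ring.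
by rewrite exprMn -!exprM lerD2r.
Qed.

Lemma potentialE P x :
  potential P x = (\int[mu]_y (P y * weight (x - y) ^+ 5)%:E)%E.
Proof. by apply: eq_integral => y _; rewrite weightX5. Qed.

Let measurable_weight_sub n : measurable_fun setT
  (fun z : MR * MR => weight (z.1 - z.2) ^+ n).
Proof.
apply: (measurableT_comp (measurable_weightX n)).
by apply: measurable_funB.
Qed.

Lemma measurable_potential P : measurable_fun setT P -> (forall y, 0 <= P y) ->
  measurable_fun setT (potential P).
Proof.
move=> mP P0.
have -> : potential P = fubini_F mu (fun z : MR * MR => (P z.2 * weight (z.1 - z.2) ^+ 5)%:E).
  by apply/funext => x; rewrite potentialE.
apply: measurable_fun_fubini_tonelli_F.
  apply/measurable_EFinP; apply: measurable_funM; last exact: measurable_weight_sub.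
  exact: (measurableT_comp mP).
by move=> z; rewrite lee_fin mulr_ge0// exprn_ge0// weight_ge0.
Qed.

(** The inequality [weighted_young] is integrated over the plane. With N = int P^2 and W = int
    weight^6 its three terms contribute N W, N W and W^2. *)
Lemma potential_weight_lty P : measurable_fun setT P -> (forall y, 0 <= P y) ->
  (\int[mu]_y (P y ^+ 2)%:E < +oo)%E ->
  (\int[mu]_x ((weight x ^+ 4)%:E * potential P x) < +oo)%E.
Proof.
move=> mP P0 P2.
have w0 n x : 0 <= weight x ^+ n by rewrite exprn_ge0// weight_ge0.
have w0E n x : (0 <= (weight x ^+ n)%:E)%E by rewrite lee_fin.
have mw n : measurable_fun setT (fun x => (weight x ^+ n)%:E).
  by apply/measurable_EFinP; exact: measurable_weightX.
have mws n x : measurable_fun setT (fun y => weight (x - y) ^+ n).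
  apply: continuous_measurable_fun => y.
  apply: (@continuous_comp _ _ _ (fun y => x - y) (fun t => weight t ^+ n)).
    by apply: cvgB; [exact: cvg_cst|exact: cvg_id].
  exact: continuous_weightX.
have mP2 : measurable_fun setT (fun y => P y ^+ 2) by exact: measurable_funX.
have [W [W0 iW iWs]] : exists W : R, [/\ 0 <= W, (\int[mu]_x (weight x ^+ 6)%:E = W%:E)%E &
    forall c, (\int[mu]_x (weight (x - c) ^+ 6)%:E = W%:E)%E].
  exists 10; split; [exact: ler0n|exact: integral_weightX6|exact: integral_weightX6_shift].
have mws2 n y : measurable_fun setT (fun x => weight (x - y) ^+ n).
  suff -> : (fun x => weight (x - y) ^+ n) = (fun x => weight (y - x) ^+ n) by exact: mws.
  by apply/funext => x; rewrite -weightN opprB.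
have iw x : (\int[mu]_y (weight (x - y) ^+ 6)%:E)%E = W%:E.
  rewrite -(iWs x); apply: eq_integral => y _.
  by rewrite -weightN opprB.
set N := (\int[mu]_y (P y ^+ 2)%:E)%E in P2.
have N0 : (0 <= N)%E by apply: integral_ge0 => y _; rewrite lee_fin sqr_ge0.
pose q (z : MR * MR) : \bar R := (P z.2 ^+ 2 * weight (z.1 - z.2) ^+ 6)%:E.
have mq : measurable_fun setT q.
  by apply/measurable_EFinP; apply: measurable_funM;
    [exact: (measurableT_comp mP2)|exact: measurable_weight_sub].
have q0 z : (0 <= q z)%E by rewrite lee_fin mulr_ge0// sqr_ge0.
pose S x := (\int[mu]_y q (x, y))%E.
have mS : measurable_fun setT S by exact: measurable_fun_fubini_tonelli_F.
have S0 x : (0 <= S x)%E by exact: integral_ge0.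
(* After the exchange of integrals the inner one is P(y)^2 W, by translation invariance. *)
have IS : (\int[mu]_x S x)%E = (N * W%:E)%E.
  have FT : (\int[mu]_x S x = \int[mu]_y \int[mu]_x q (x, y))%E.
    exact: (@fubini_tonelli _ _ _ _ R mu mu q mq q0).
  rewrite FT; transitivity (\int[mu]_y ((P y ^+ 2)%:E * W%:E))%E; last first.
    apply: (ge0_integralZr mu measurableT (proj2 (measurable_EFinP _ _) mP2)).
      by move=> y _; rewrite lee_fin sqr_ge0.
    by rewrite lee_fin.
  apply: eq_integral => y _; rewrite -(iWs y).
  rewrite -ge0_integralZl; [by []|exact: measurableT| | |by rewrite lee_fin sqr_ge0].
    by apply/measurable_EFinP; exact: mws2.
  by move=> x _; rewrite lee_fin.
have mN : measurable_fun setT (fun x => ((weight x ^+ 6)%:E * N)%E) by apply: emeasurable_funM; [exact: mw|exact: measurable_cst].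
have m10 : measurable_fun setT (fun x => ((weight x ^+ 6)%:E * W%:E)%E) by apply: emeasurable_funM; [exact: mw|exact: measurable_cst].
have wN0 x : (0 <= (weight x ^+ 6)%:E * N)%E by rewrite mule_ge0// lee_fin.
have w100 x : (0 <= (weight x ^+ 6)%:E * W%:E)%E by rewrite mule_ge0// lee_fin.
apply: (@le_lt_trans _ _ (\int[mu]_x ((weight x ^+ 6)%:E * N + S x + (weight x ^+ 6)%:E * W%:E))%E).
  apply: ge0_le_integral => //.
  - by move=> x _; rewrite mule_ge0 ?lee_fin// potential_ge0.
  - by apply: emeasurable_funM; [exact: mw|exact: measurable_potential mP P0].
  - apply: emeasurable_funD; first apply: emeasurable_funD => //.
    exact: m10.
  - move=> x _; rewrite potentialE.
    pose g1 y := weight x ^+ 6 * P y ^+ 2; pose g2 y := P y ^+ 2 * weight (x - y) ^+ 6.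
    pose g3 y := weight x ^+ 6 * weight (x - y) ^+ 6.
    have mg1 : measurable_fun setT (fun y => (g1 y)%:E).
      by apply/measurable_EFinP; apply: measurable_funM.
    have mg2 : measurable_fun setT (fun y => (g2 y)%:E).
      by apply/measurable_EFinP; apply: measurable_funM.
    have mg3 : measurable_fun setT (fun y => (g3 y)%:E).
      by apply/measurable_EFinP; apply: measurable_funM.
    have g10 y : (0 <= (g1 y)%:E)%E by rewrite lee_fin mulr_ge0// sqr_ge0.
    have g20 y : (0 <= (g2 y)%:E)%E by rewrite lee_fin mulr_ge0// sqr_ge0.
    have g30 y : (0 <= (g3 y)%:E)%E by rewrite lee_fin mulr_ge0.
    have g12 y : (0 <= (g1 y)%:E + (g2 y)%:E)%E by exact: adde_ge0.
    have mg12 : measurable_fun setT (fun y => ((g1 y)%:E + (g2 y)%:E)%E) by exact: emeasurable_funD.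
    have -> : ((weight x ^+ 6)%:E * N = \int[mu]_y (g1 y)%:E)%E.
      rewrite /N -ge0_integralZl; [by []|exact: measurableT| | |exact: w0E].
        exact/measurable_EFinP.
      by move=> y _; rewrite lee_fin sqr_ge0.
    have -> : ((weight x ^+ 6)%:E * W%:E = \int[mu]_y (g3 y)%:E)%E.
      rewrite -(iw x) -ge0_integralZl; [by []|exact: measurableT| | |exact: w0E].
        by apply/measurable_EFinP; exact: mws.
      by move=> y _; exact: w0E.
    have -> : S x = (\int[mu]_y (g2 y)%:E)%E by [].
    rewrite -(ge0_integralD mu measurableT (fun y _ => g10 y) mg1 (fun y _ => g20 y) mg2).
    rewrite -(ge0_integralD mu measurableT (fun y _ => g12 y) mg12 (fun y _ => g30 y) mg3).
    rewrite -ge0_integralZl; [|exact: measurableT| | |exact: w0E]; last 2 first.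
      by apply/measurable_EFinP; apply: measurable_funM; [exact: mP|exact: mws].
      by move=> y _; rewrite lee_fin mulr_ge0.
    have mL : measurable_fun setT (fun y => ((weight x ^+ 4)%:E * (P y * weight (x - y) ^+ 5)%:E)%E).
      apply: emeasurable_funM; first exact: measurable_cst.
      by apply/measurable_EFinP; apply: measurable_funM; [exact: mP|exact: mws].
    apply: (ge0_le_integral mu measurableT _ mL).
    + move=> y _; rewrite -EFinM lee_fin; exact: (mulr_ge0 (w0 4 x) (mulr_ge0 (P0 y) (w0 5 (x - y)))).
    + exact: (emeasurable_funD mg12 mg3).
    + by move=> y _; rewrite -EFinM -!EFinD lee_fin /g1 (mulrC _ (P y ^+ 2)); apply: weighted_young; rewrite ?weight_ge0.
have wNS0 x : (0 <= (weight x ^+ 6)%:E * N + S x)%E by exact: adde_ge0.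
rewrite (ge0_integralD mu measurableT (fun x _ => wNS0 x) (emeasurable_funD mN mS) (fun x _ => w100 x) m10).
rewrite (ge0_integralD mu measurableT (fun x _ => wN0 x) mN (fun x _ => S0 x) mS) IS.
rewrite (ge0_integralZr mu measurableT (mw 6) (fun x _ => w0E 6 x) N0).
rewrite (ge0_integralZr mu measurableT (mw 6) (fun x _ => w0E 6 x)); last by rewrite lee_fin.
have /fineK <- : N \is a fin_num by rewrite ge0_fin_numE.
by rewrite iW -!EFinM -!EFinD ltry.
Qed.

End weighted_potential.

(** * Integral bounds through extended-real majorants *)

Section majorants.
Context {R : realType}.
Local Notation mu := (@lebesgue_measure R).
Implicit Types (x y z c : R).

(* No measurability is required: the integral of a nonnegative function is a
   supremum over the simple functions below it. *)
Lemma ge0_le_lower_integral (D : set R) (f1 f2 : R -> \bar R) :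
  (forall x, D x -> (0 <= f1 x)%E) -> (forall x, D x -> (f1 x <= f2 x)%E) ->
  (\int[mu]_(x in D) f1 x <= \int[mu]_(x in D) f2 x)%E.
Proof.
move=> f0 f12; rewrite !ge0_integralE//; last first.
  by move=> x Dx; apply: le_trans (f0 _ Dx) (f12 _ Dx).
apply: ereal_sup_le => _ [h hf <-]; exists h => // x.
apply: le_trans (hf x) _; rewrite !patchE; case: ifPn => // xD.
by apply: f12; rewrite inE in xD.
Qed.

(** The integrals of the positive and negative parts both lie in [0, c], hence so does the absolute
    value of their difference. This is meant for [hilbert G], of which only a majorant is at
    hand. *)
Lemma normr_Rintegral_le_majorant (D : set R) (f : R -> R) (B : R -> \bar R) c :
  (forall x, D x -> (`|f x|%:E <= B x)%E) -> (\int[mu]_(x in D) B x <= c%:E)%E ->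
  `|\int[mu]_(x in D) f x| <= c.
Proof.
move=> fB Bc.
have B0 x : D x -> (0 <= B x)%E by move=> /fB; apply: le_trans; rewrite lee_fin.
have pos : (0 <= \int[mu]_(x in D) (EFin \o f)^\+ x <= c%:E)%E.
  rewrite integral_ge0//=; apply: le_trans Bc; apply: ge0_le_lower_integral => //.
  move=> x Dx; apply: le_trans (fB _ Dx); rewrite funeposE /= -EFin_max lee_fin.
  by rewrite ge_max ler_norm normr_ge0.
have neg : (0 <= \int[mu]_(x in D) (EFin \o f)^\- x <= c%:E)%E.
  rewrite integral_ge0//=; apply: le_trans Bc; apply: ge0_le_lower_integral => //.
  move=> x Dx; apply: le_trans (fB _ Dx); rewrite funenegE /= -EFin_max lee_fin.
  by rewrite ge_max -normrN ler_norm normr_ge0.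
rewrite /Rintegral integralE.
move: pos neg; case: (integral _ _ _) => [a| |]; case: (integral _ _ _) => [b| |] //=;
  rewrite ?leye_eq ?andbF// !lee_fin => /andP[? ?] /andP[? ?].
by rewrite ler_norml; apply/andP; split; lra.
Qed.

Lemma weight_le y z : `|y| <= `|z| -> weight z <= weight y.
Proof.
move=> yz; rewrite -(@ler_pXn2r _ 5)// ?nnegrE ?weight_ge0// !weightX5.
by rewrite lef_pV2 ?posrE ?ltr_pwDl// lerD2l.
Qed.

(** The weight decreases in |y|, so between 0 and z the function B is at most weight(z)^(-4) times
    weight^4 B. The resulting growth is of order (1 + |z|)^(4/5). *)
Lemma Lambda_inv_le (G : R -> R) (B : R -> \bar R) c z :
  measurable_fun setT B ->
  (forall x, (`|hilbert G x|%:E <= B x)%E) ->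
  (\int[mu]_x ((weight x ^+ 4)%:E * B x) <= c%:E)%E ->
  `|Lambda_inv G z| <= c / weight z ^+ 4.
Proof.
move=> mB HB Bc.
have B0 x : (0 <= B x)%E by apply: le_trans (HB x); rewrite lee_fin.
have w4 x : 0 < weight x ^+ 4 by rewrite exprn_gt0// weight_gt0.
have mwB : measurable_fun setT (fun x => ((weight x ^+ 4)%:E * B x)%E).
  by apply: emeasurable_funM => //; apply/measurable_EFinP; exact: measurable_weightX.
have wB0 x : (0 <= (weight x ^+ 4)%:E * B x)%E by rewrite mule_ge0// lee_fin ltW.
have key (D : set R) : measurable D -> (forall y, D y -> `|y| <= `|z|) ->
    `|\int[mu]_(y in D) hilbert G y| <= c / weight z ^+ 4.
  move=> mD Dz; apply: (normr_Rintegral_le_majorant (fun x _ => HB x)).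
  apply: (@le_trans _ _ (\int[mu]_(y in D) ((weight z ^+ 4)^-1%:E * ((weight y ^+ 4)%:E * B y)))%E).
    apply: ge0_le_lower_integral => // y Dy.
    rewrite muleA -EFinM -[leLHS]mul1e lee_wpmul2r// lee_fin mulrC ler_pdivlMr// mul1r.
    by rewrite lerXn2r ?nnegrE ?weight_ge0// weight_le// Dz.
  rewrite ge0_integralZl//; last 2 first.
    exact: measurable_funTS.
    by rewrite lee_fin invr_ge0 ltW.
  rewrite mulrC EFinM lee_wpmul2l//; first by rewrite lee_fin invr_ge0 ltW.
  by apply: le_trans Bc; apply: ge0_subset_integral.
rewrite /Lambda_inv; case: ifPn => z0.
  apply: key => // y; rewrite /= in_itv /= => /andP[y0 yz].
  by rewrite !ger0_norm.
rewrite normrN; apply: key => // y; rewrite /= in_itv /= => /andP[zy y0].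
by rewrite -ltNge in z0; rewrite !ler0_norm ?lerN2// ltW.
Qed.

Lemma measurable_le_norm (M : R) : measurable [set x : R | M <= `|x|].
Proof.
have -> : [set x : R | M <= `|x|] = ~` `]- M, M[%classic.
  apply/seteqP; split => x; rewrite /= in_itv /= -ltr_norml.
    by move=> Mx /lt_geF; rewrite Mx.
  by move/negP; rewrite -leNgt.
exact: measurableC.
Qed.

(** Dominated convergence for the restrictions of k to n <= |x|, which vanish at any given point for
    large n. *)
Lemma integral_tail (k : R -> \bar R) (e : R) : measurable_fun setT k ->
  (forall x, (0 <= k x)%E) -> (\int[mu]_x k x < +oo)%E -> 0 < e ->
  exists2 M, 0 < M & (\int[mu]_(x in [set x | (M <= `|x|)%R]) k x <= e%:E)%E.
Proof.
move=> mk k0 koo e0.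
pose T n : set R := [set x | n%:R <= `|x|].
have mT n : measurable (T n) by exact: measurable_le_norm.
have ik : mu.-integrable setT k.
  apply/integrableP; split => //; apply: le_lt_trans koo.
  by rewrite le_eqVlt; apply/orP; left; apply/eqP; apply: eq_integral => x _; rewrite gee0_abs.
have [||||_ _ D] := @dominated_convergence _ _ _ mu setT measurableT
  (fun n => k \_ (T n)) (cst 0%E) k _ _ _ ik _.
- by move=> n; apply/(measurable_restrictT _ (mT n)); exact: measurable_funTS.
- exact: measurable_cst.
- apply: aeW => x _; apply: cvg_near_cst; near=> n.
  rewrite patchE memNset//= /T /=; apply/negP; rewrite -ltNge.
  by near: n; exact: nbhs_infty_gtr.
- by apply: aeW => x n _; rewrite patchE; case: ifPn => _; rewrite ?gee0_abs ?abse0.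
rewrite integral_cst// mul0e in D.
have /fine_cvgP[Dfin Dcvg] := D.
have Dle : \forall n \near \oo, `|fine (\int[mu]_x (k \_ (T n)) x)%E| <= e.
  exact: cvgr0_norm_le Dcvg _ e0.
near \oo => n.
have n0 : (0 < n)%N by near: n; exact: nbhs_infty_gt.
exists n%:R; first by rewrite ltr0n.
have fn : (\int[mu]_x (k \_ (T n)) x)%E \is a fin_num by near: n.
rewrite integral_mkcond -/(T n) -(fineK fn) lee_fin.
by apply: le_trans (ler_norm _) _; near: n.
Unshelve. all: by end_near. Qed.

End majorants.

(** * Decay of the profile *)

Section gronwall.
Context {R : realType}.
Local Notation mu := (@lebesgue_measure R).
Implicit Types (x y z p q c : R).

(** With m a maximum point of |u|, all increments of u are at most |u m| / 2, so |u m| <= |u x| + |u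
    m| / 2. No division by u occurs. *)
Lemma gronwall_half (u u' : R -> R) (K : R -> \bar R) p q :
  (forall x, x \in `[p, q] -> is_derive x 1 u (u' x)) ->
  {within `[p, q], continuous u'} ->
  measurable_fun setT K -> (forall x, (0 <= K x)%E) ->
  (forall x, x \in `[p, q] -> (`|u' x|%:E <= `|u x|%:E * K x)%E) ->
  (\int[mu]_(x in `[p, q]) K x <= (2^-1)%:E)%E ->
  forall x y, x \in `[p, q] -> y \in `[p, q] -> `|u y| <= 2 * `|u x|.
Proof.
move=> du cu' mK K0 u'K intK x y xpq ypq.
have pq : p <= q by move: xpq; rewrite in_itv /= => /andP[]; exact: le_trans.
have cu z : z \in `[p, q] -> {for z, continuous u}.
  move=> zpq; apply/differentiable_continuous/derivable1_diffP.
  by have [] := du z zpq.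
have cnu : {within `[p, q], continuous (fun z => `|u z|)}.
  apply/continuous_in_subspaceT => z; rewrite inE /= => zpq.
  by apply: cvg_norm; exact: cu.
have [m mpq um] := EVT_max pq cnu.
have FTC s t : s \in `[p, q] -> t \in `[p, q] -> s < t -> `|u t - u s| <= `|u m| / 2.
  move=> spq tpq st.
  have sub : `[s, t] `<=` `[p, q].
    move: spq tpq; rewrite !in_itv /= => /andP[ps _] /andP[_ tq].
    by apply: subset_itv; rewrite bnd_simp.
  have subi z : z \in `[s, t] -> z \in `[p, q] by move=> /sub.
  have dui z : z \in `]s, t[ -> is_derive z 1 u (u' z).
    by move=> zst; apply: du; apply: subi; exact: subset_itv_oo_cc.
  have cst' : {within `[s, t], continuous u'} by exact: continuous_subspaceW cu'.
  have -> : u t - u s = \int[mu]_(z in `[s, t]) u' z.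
    rewrite /Rintegral (@continuous_FTC2 _ u' u) //.
    - split.
      + by move=> z /dui[].
      + by apply: cvg_at_right_filter; exact: cu.
      + by apply: cvg_at_left_filter; exact: cu.
    - by move=> z /dui[_]; rewrite derive1E.
  apply: (@normr_Rintegral_le_majorant _ _ _ (fun z => `|u m|%:E * K z)%E).
    move=> z zst; have zpq : z \in `[p, q] by exact: subi.
    apply: le_trans (u'K _ zpq) _; apply: lee_wpmul2r => //.
    by rewrite lee_fin um.
  rewrite ge0_integralZl//; last exact: measurable_funTS.
  rewrite EFinM lee_wpmul2l//; apply: le_trans intK.
  by apply: ge0_subset_integral => //; exact: measurable_funTS.
have um2 : `|u m| <= 2 * `|u x|.
  have : `|u m - u x| <= `|u m| / 2.
    have [mx|xm|->] := ltgtP m x.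
    - by rewrite distrC FTC.
    - by rewrite FTC.
    - by rewrite subrr normr0 divr_ge0.
  have := lerB_dist (u m) (u x); lra.
exact: le_trans (um _ ypq) um2.
Qed.

(** Writing |z|^al as (z^2)^(al/2) lets one formula cover both signs of z. *)
Lemma is_derive_sqr_powR (al z : R) : z != 0 ->
  is_derive z 1 (fun z => (z ^+ 2) `^ (al / 2)) (al * (z ^+ 2) `^ (al / 2) / z).
Proof.
move=> z0; have p0 : 0 < z ^+ 2 by rewrite exprn_even_gt0.
have H2 : is_derive z 1 (fun z : R => z ^+ 2) (2 * z).
  by apply: (is_derive_eq (is_deriveX 2 (is_derive_id z (1:R)))); rewrite /GRing.scale /= mulr1.
have := @is_derive1_comp _ (fun y => y `^ (al / 2)) (fun z => z ^+ 2) z _ _ (is_derive1_powR (al / 2) p0) H2.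
move=> H; apply: (is_derive_eq H).
rewrite powRB; last by rewrite (gt_eqF p0) implybT.
by rewrite powRr1 ?ltW//; field.
Qed.

(* The left-hand side is the derivative of |z|^(1/c) g, divided by |z|^(1/c). *)
Lemma log_derivative_le (g d H L a c z : R) : 0 < c -> z != 0 ->
  `|a * L| <= c * `|z| / 2 ->
  g + (c * z - a * L) * d + 2 * g * H = 0 ->
  `|d + g / (c * z)| <= `|g| * (4 / c * (`|H| / `|z|) + 2 / c ^+ 2 * (`|a| * (`|L| / `|z| ^+ 2))).
Proof.
move=> c0 z0 aL E.
have nz : 0 < `|z| by rewrite normr_gt0.
have den : c * `|z| / 2 <= `|c * z - a * L|.
  have := lerB_dist (c * z) (a * L); rewrite normrM (gtr0_norm c0); lra.
have den0 : 0 < c * `|z| / 2 by rewrite divr_gt0// mulr_gt0.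
(* The term g of the equation cancels against the product of c z and g / (c z); this is what singles
   out the exponent 1/c. *)
have Eq : (c * z - a * L) * (d + g / (c * z)) = - g * (2 * H + a * L / (c * z)).
  have -> : (c * z - a * L) * (d + g / (c * z)) =
    (g + (c * z - a * L) * d + 2 * g * H) - g * (2 * H + a * L / (c * z)).
    by field; rewrite z0 gt_eqF.
  by rewrite E add0r mulNr.
have : `|c * z - a * L| * `|d + g / (c * z)| <= `|g| * (2 * `|H| + `|a| * `|L| / (c * `|z|)).
  rewrite -normrM Eq normrM normrN ler_wpM2l//.
  apply: le_trans (ler_normD _ _) _; rewrite normrM ger0_norm// lerD2l.
  by rewrite !normrM normfV normrM (gtr0_norm c0).
move=> le1.
have : c * `|z| / 2 * `|d + g / (c * z)| <= `|g| * (2 * `|H| + `|a| * `|L| / (c * `|z|)).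
  by apply: le_trans le1; rewrite ler_wpM2r.
rewrite -ler_pdivlMl// => /le_trans; apply.
rewrite le_eqVlt; apply/orP; left; apply/eqP.
move: (`|z|) nz (`|g|) (`|H|) (`|a|) (`|L|) => Z Z0 *.
by field; rewrite !gt_eqF.
Qed.

End gronwall.

Section decay.
Context {R : realType}.
Local Notation mu := (@lebesgue_measure R).
Implicit Types (x y z a l : R) (G D h : R -> R).

Lemma sqr_integrable_sum3 (f g h : R -> R) : measurable_fun setT f ->
  measurable_fun setT g -> measurable_fun setT h ->
  (\int[mu]_y (f y ^+ 2)%:E < +oo)%E -> (\int[mu]_y (g y ^+ 2)%:E < +oo)%E ->
  (\int[mu]_y (h y ^+ 2)%:E < +oo)%E ->
  (\int[mu]_y ((`|f y| + `|g y| + `|h y|) ^+ 2)%:E < +oo)%E.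
Proof.
move=> mf mg mh f2 g2 h2.
have m2 (k : R -> R) : measurable_fun setT k -> measurable_fun setT (fun y => (k y ^+ 2)%:E).
  by move=> mk; apply/measurable_EFinP; exact: measurable_funX.
have p2 (k : R -> R) y : (0 <= (k y ^+ 2)%:E)%E by rewrite lee_fin sqr_ge0.
have p22 y : (0 <= (f y ^+ 2)%:E + (g y ^+ 2)%:E)%E by exact: adde_ge0.
have p222 y : (0 <= (f y ^+ 2)%:E + (g y ^+ 2)%:E + (h y ^+ 2)%:E)%E by exact: adde_ge0.
have m22 := emeasurable_funD (m2 _ mf) (m2 _ mg).
have m222 := emeasurable_funD m22 (m2 _ mh).
apply: (@le_lt_trans _ _ (\int[mu]_y (3%:E * ((f y ^+ 2)%:E + (g y ^+ 2)%:E + (h y ^+ 2)%:E)))%E).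
  apply: ge0_le_lower_integral => y _; first by rewrite lee_fin sqr_ge0.
  rewrite -!EFinD -EFinM lee_fin.
  have := real_normK (num_real (f y)); have := real_normK (num_real (g y)).
  have := real_normK (num_real (h y)); move: (`|f y|) (`|g y|) (`|h y|) => u v w.
  move=> <- <- <-; have := sqr_ge0 (u - v); have := sqr_ge0 (u - w); have := sqr_ge0 (v - w).
  by nra.
rewrite (ge0_integralZl mu measurableT m222 (fun y _ => p222 y)); last by rewrite lee_fin.
rewrite (ge0_integralD mu measurableT (fun y _ => p22 y) m22 (fun y _ => p2 h y) (m2 _ mh)).
rewrite (ge0_integralD mu measurableT (fun y _ => p2 f y) (m2 _ mf) (fun y _ => p2 g y) (m2 _ mg)).
apply: lte_mul_pinfty; [by rewrite lee_fin|by []|].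
apply: lte_add_pinfty; last exact: h2.
by apply: lte_add_pinfty; [exact: f2|exact: g2].
Qed.

(** Multiplied by |z|^(1/(1 + l)), the last inequality reads |u'| <= |u| K, as [gronwall_half]
    requires. *)
Lemma log_derivative_majorant G D h a l : is_C1_jet G D h ->
  (\int[mu]_y (G y ^+ 2)%:E < +oo)%E -> (\int[mu]_y (D y ^+ 2)%:E < +oo)%E ->
  (\int[mu]_y (h y ^+ 2)%:E < +oo)%E -> 0 < 1 + l -> profile_equation a l G ->
  exists K : R -> \bar R, exists M : R,
  [/\ measurable_fun setT K, forall x, (0 <= K x)%E, 0 < M,
      (\int[mu]_(x in [set x | (M <= `|x|)%R]) K x <= (2^-1)%:E)%E &
      forall z, M <= `|z| -> (`|D z + G z / ((1 + l) * z)|%:E <= `|G z|%:E * K z)%E].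
Proof.
move=> GDh G2 D2 h2 c0 eqG; have cG := is_C1_jet_continuous GDh.
have [cD dG hL2 _] := GDh.
set c := 1 + l in c0 *.
pose P y : R := `|G y| + `|D y| + `|h y|.
have mG : measurable_fun setT G by exact: continuous_measurable_fun.
have mD : measurable_fun setT D by exact: continuous_measurable_fun.
have mh := Lfun2_measurable hL2.
have P0 y : 0 <= P y by rewrite !addr_ge0.
have mP : measurable_fun setT P.
  by apply: measurable_funD; [apply: measurable_funD|]; apply: measurableT_comp.
have Poo := potential_weight_lty mP P0 (sqr_integrable_sum3 mG mD mh G2 D2 h2).
have mpot := measurable_potential mP P0.
have pot0 x : (0 <= potential P x)%E by exact: potential_ge0.
pose B x := (6%:E * potential P x)%E.
have mB : measurable_fun setT B.
  by apply: emeasurable_funM => //; exact: measurable_cst.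
have B0 x : (0 <= B x)%E by rewrite mule_ge0// lee_fin.
have HB x : (`|hilbert G x|%:E <= B x)%E by exact: hilbert_le.
have w4 n x : 0 <= weight x ^+ n by rewrite exprn_ge0// weight_ge0.
have w4E n x : (0 <= (weight x ^+ n)%:E)%E by rewrite lee_fin.
have mw n : measurable_fun setT (fun x => (weight x ^+ n)%:E).
  by apply/measurable_EFinP; exact: measurable_weightX.
have mwp := emeasurable_funM (mw 4) mpot.
have mwB := emeasurable_funM (mw 4) mB.
have wB0 x : (0 <= (weight x ^+ 4)%:E * B x)%E by exact: mule_ge0.
have Boo : (\int[mu]_x ((weight x ^+ 4)%:E * B x) < +oo)%E.
  rewrite /B; under eq_integral do rewrite muleCA.
  rewrite (ge0_integralZl mu measurableT mwp); last 2 first.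
    by move=> x _; apply: mule_ge0; [exact: w4E|exact: pot0].
    by rewrite lee_fin.
  by apply: lte_mul_pinfty; [rewrite lee_fin|by []|exact: Poo].
set IB := (\int[mu]_x ((weight x ^+ 4)%:E * B x))%E in Boo.
have IB0 : (0 <= IB)%E by exact: integral_ge0.
have [C C0 IBC] : exists2 C : R, 0 <= C & IB = C%:E.
  exists (fine IB); first exact: fine_ge0.
  by rewrite fineK// ge0_fin_numE.
have LB z : `|Lambda_inv G z| <= C / weight z ^+ 4.
  by apply: (Lambda_inv_le z mB HB); rewrite -/IB IBC.
(* For |z| >= 1, 1/|z| <= 2 weight^5. In [log_derivative_le] this bounds |L| / |z|^2 by 4 C weight^6
   and |H| / |z| by 2 weight^4 B, with prefactors 2 |a| / c^2 and 4 / c. *)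
pose k1 := 8 * `|a| * C / c ^+ 2; pose k2 := 8 / c.
have k10 : 0 <= k1 by rewrite divr_ge0 ?sqr_ge0// !mulr_ge0.
have k20 : 0 <= k2 by rewrite divr_ge0// ltW.
pose K x := (k1%:E * (weight x ^+ 6)%:E + k2%:E * ((weight x ^+ 4)%:E * B x))%E.
have K1 x : (0 <= k1%:E * (weight x ^+ 6)%:E)%E by rewrite mule_ge0// lee_fin.
have K2 x : (0 <= k2%:E * ((weight x ^+ 4)%:E * B x))%E by rewrite mule_ge0// lee_fin.
have mK1 := emeasurable_funM (measurable_cst k1%:E) (mw 6).
have mK2 := emeasurable_funM (measurable_cst k2%:E) mwB.
have K0 x : (0 <= K x)%E by exact: adde_ge0.
have mK : measurable_fun setT K by exact: (emeasurable_funD mK1 mK2).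
have Koo : (\int[mu]_x K x < +oo)%E.
  rewrite (ge0_integralD mu measurableT (fun x _ => K1 x) mK1 (fun x _ => K2 x) mK2).
  rewrite (ge0_integralZl mu measurableT (mw 6) (fun x _ => w4E 6 x)); last by rewrite lee_fin.
  rewrite (ge0_integralZl mu measurableT mwB (fun x _ => wB0 x)); last by rewrite lee_fin.
  by rewrite integral_weightX6 -/IB IBC -!EFinM -EFinD ltry.
have [M2 M20 tailM2] := integral_tail mK K0 Koo (ltac:(by rewrite invr_gt0) : 0 < 2^-1).
(* Since weight^(-4) = weight (1 + |z|), the bounds weight z <= d and |a| C d <= c / 4 yield |a
   Lambda^(-1)G| <= c |z| / 2 for |z| >= 1. The added 1 keeps the denominator positive when a C =
   0. *)
pose d := c / (4 * (`|a| * C + 1)).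
have aC : 0 <= `|a| * C by rewrite mulr_ge0.
have d0 : 0 < d by rewrite divr_gt0// mulr_gt0// ltr_wpDl.
(* The summands ensure |z| >= 1, weight z <= d and the smallness of the tail integral,
   respectively. *)
pose M := 1 + d ^- 5 + M2.
have M1 : 1 <= M by rewrite /M -addrA lerDl addr_ge0 ?ltW// invr_gt0 exprn_gt0.
have Md : d ^- 5 <= M.
  by rewrite /M [1 + _]addrC -addrA lerDl addr_ge0// ltW.
have MM2 : M2 <= M.
  by rewrite /M lerDr addr_ge0// invr_ge0 exprn_ge0// ltW.
exists K, M; split => //; first exact: lt_le_trans M1.
  apply: le_trans tailM2; apply: ge0_subset_integral => //.
  - exact: measurable_le_norm.
  - exact: measurable_le_norm.
  - exact: measurable_funTS.
  - by move=> x /= Mx; exact: le_trans MM2 Mx.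
move=> z Mz.
have z1 : 1 <= `|z| by exact: le_trans M1 Mz.
have z0 : z != 0 by rewrite -normr_gt0; exact: lt_le_trans z1.
have w0 := @weight_gt0 R z.
have wd : weight z <= d.
  rewrite -(@ler_pXn2r _ 5)// ?nnegrE ?(ltW w0) ?(ltW d0)// weightX5.
  rewrite -[leRHS]invrK lef_pV2 ?posrE ?invr_gt0 ?exprn_gt0// ?ltr_pwDl//.
  by apply: le_trans Md _; apply: le_trans Mz _; rewrite lerDr.
have inv1 : `|z|^-1 <= 2 * weight z ^+ 5.
  by rewrite weightX5 -[leLHS]div1r ler_pdivrMr ?(lt_le_trans ltr01)// mulrAC ler_pdivlMr ?ltr_pwDl//; lra.
have aL : `|a * Lambda_inv G z| <= c * `|z| / 2.
  rewrite normrM; apply: (@le_trans _ _ (`|a| * (C / weight z ^+ 4))); first by rewrite ler_wpM2l.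
  have -> : `|a| * (C / weight z ^+ 4) = `|a| * C * (weight z * (1 + `|z|)).
    have -> : 1 + `|z| = (weight z ^+ 5)^-1 by rewrite weightX5 invrK.
    by field; rewrite gt_eqF.
  apply: (@le_trans _ _ (`|a| * C * (d * (2 * `|z|)))).
    rewrite ler_wpM2l// ler_pM ?(ltW w0)// ?addr_ge0//; lra.
  have qd : `|a| * C * d <= c / 4.
    by rewrite /d mulrA ler_pdivrMr ?mulr_gt0 ?ltr_wpDl//; lra.
  have -> : `|a| * C * (d * (2 * `|z|)) = `|a| * C * d * (2 * `|z|) by ring.
  have -> : c * `|z| / 2 = c / 4 * (2 * `|z|) by field.
  by rewrite ler_wpM2r// mulr_ge0.
have dGz : derive1 G z = D z by rewrite derive1E; have [_ ->] := dG z.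
have Ez := eqG z; rewrite dGz -/c in Ez.
have := log_derivative_le c0 z0 aL Ez.
rewrite -lee_fin => /le_trans; apply.
rewrite EFinM lee_wpmul2l// /K addeC EFinD leeD//.
  apply: (@le_trans _ _ (k2%:E * ((weight z ^+ 4)%:E * `|hilbert G z|%:E))%E).
    rewrite -!EFinM lee_fin /k2.
    apply: (@le_trans _ _ (4 / c * (`|hilbert G z| * (2 * weight z ^+ 5)))).
      by rewrite ler_wpM2l ?divr_ge0 ?(ltW c0)// ler_wpM2l.
    have -> : 4 / c * (`|hilbert G z| * (2 * weight z ^+ 5)) =
              8 / c * (weight z ^+ 4 * `|hilbert G z|) * weight z.
      by field; rewrite gt_eqF.
    rewrite ler_piMr ?weight_le1//.
    exact: (mulr_ge0 k20 (mulr_ge0 (w4 4 z) (normr_ge0 _))).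
  by rewrite lee_wpmul2l ?lee_fin// lee_wpmul2l.
rewrite -EFinM lee_fin /k1.
apply: (@le_trans _ _ (2 / c ^+ 2 * (`|a| * (C / weight z ^+ 4 * (2 * weight z ^+ 5) ^+ 2)))).
  rewrite ler_wpM2l ?divr_ge0 ?sqr_ge0// ler_wpM2l// ler_pM ?invr_ge0 ?sqr_ge0//.
  rewrite -exprVn lerXn2r ?nnegrE ?invr_ge0//.
  exact: (mulr_ge0 (ler0n _ 2) (w4 5 z)).
rewrite le_eqVlt; apply/orP; left; apply/eqP.
by field; rewrite !gt_eqF.
Qed.

End decay.

Section profile_decay.
Context {R : realType}.
Local Notation mu := (@lebesgue_measure R).
Implicit Types (x y z a l : R) (G D h : R -> R).

Lemma sqr_powR_half (al z : R) : (z ^+ 2) `^ (al / 2) = `|z| `^ al.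
Proof.
rewrite -real_normK ?num_real// -powR_mulrn// -powRrM; congr (_ `^ _).
by field.
Qed.

Lemma profile_decay G D h a l : is_C1_jet G D h ->
  (\int[mu]_y (G y ^+ 2)%:E < +oo)%E -> (\int[mu]_y (D y ^+ 2)%:E < +oo)%E ->
  (\int[mu]_y (h y ^+ 2)%:E < +oo)%E -> 0 < 1 + l -> profile_equation a l G ->
  exists2 C, 0 <= C & forall z, `|G z| <= C * (1 + `|z|) `^ (- (1 + l)^-1).
Proof.
move=> GDh G2 D2 h2 c0 eqG; have cG := is_C1_jet_continuous GDh.
have [K [M [mK K0 M0 tailK DK]]] := log_derivative_majorant GDh G2 D2 h2 c0 eqG.
have [cD dG _ _] := GDh.
set c := 1 + l in c0 DK *.
pose al := c^-1; have al0 : 0 < al by rewrite invr_gt0.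
pose s z := (z ^+ 2) `^ (al / 2); have s0 z : 0 <= s z by exact: powR_ge0.
pose u z := s z * G z.
pose u' z := s z * (D z + G z / (c * z)).
have ds z : z != 0 -> is_derive z 1 s (al * s z / z) by exact: is_derive_sqr_powR.
(* The integral of K over the whole tail is at most 1/2, so the factor 2 is the same for every
   interval outside ]-M, M[. *)
have gronwall p q : (forall z, z \in `[p, q] -> M <= `|z|) ->
    forall x y, x \in `[p, q] -> y \in `[p, q] -> `|u y| <= 2 * `|u x|.
  move=> pqM.
  have z0 z : z \in `[p, q] -> z != 0.
    by move=> /pqM Mz; rewrite -normr_gt0; exact: lt_le_trans Mz.
  apply: (@gronwall_half _ u u' K) => //.
  - move=> z zpq; have zn0 := z0 _ zpq.
    apply: (is_derive_eq (is_deriveM (ds z zn0) (dG z))).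
    rewrite /u' /GRing.scale /= /al; field.
    by rewrite zn0 gt_eqF.
  - apply/continuous_in_subspaceT => z; rewrite inE /= => zpq; have zn0 := z0 _ zpq.
    apply: cvgM.
      apply/differentiable_continuous/derivable1_diffP.
      by have [] := ds z zn0.
    apply: cvgD; first exact: cD.
    apply: cvgM; first exact: cG.
    apply: cvgV; first by rewrite mulf_neq0// gt_eqF.
    by apply: cvgM; [exact: cvg_cst|exact: cvg_id].
  - move=> z zpq; rewrite /u' /u !normrM (ger0_norm (s0 z)) !EFinM -muleA.
    by rewrite lee_wpmul2l ?lee_fin// DK// pqM.
  - apply: le_trans tailK; apply: ge0_subset_integral => //.
    + exact: measurable_le_norm.
    + exact: measurable_funTS.
pose U := 2 * `|u M| + 2 * `|u (- M)|.
have U0 : 0 <= U by rewrite addr_ge0// mulr_ge0.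
have uU z : M <= `|z| -> `|u z| <= U.
  move=> Mz; have [z0|/ltW z0] := leP 0 z.
    rewrite ger0_norm// in Mz.
    apply: (@le_trans _ _ (2 * `|u M|)); last by rewrite lerDl mulr_ge0.
    apply: (gronwall M z); rewrite ?in_itv /= ?lexx ?Mz//.
    move=> t; rewrite in_itv /= => /andP[Mt _]; exact: le_trans (ler_norm _).
  rewrite ler0_norm// in Mz.
  apply: (@le_trans _ _ (2 * `|u (- M)|)); last by rewrite lerDr mulr_ge0.
  have zM : z <= - M by rewrite lerNr.
  apply: (gronwall z (- M)); rewrite ?in_itv /= ?lexx ?zM//.
  move=> t; rewrite in_itv /= => /andP[_ tM].
  by rewrite ler0_norm; lra.
have MM : - M <= M by lra.
have cnG : {within `[- M, M], continuous (fun z => `|G z|)}.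
  by apply: continuous_subspaceT => z; apply: cvg_norm; exact: cG.
have [m mM Gm] := EVT_max MM cnG.
(* For |z| >= M, 1 + |z| <= (1 + 1/M) |z| turns the bound U on |z|^al |G z| into one on (1 + |z|)^al
   |G z|; on [-M, M] the maximum of |G| serves. *)
pose T := (1 + M^-1) `^ al * U + (1 + M) `^ al * `|G m|.
have T1 : 0 <= (1 + M^-1) `^ al * U by rewrite mulr_ge0// powR_ge0.
have T2 : 0 <= (1 + M) `^ al * `|G m| by rewrite mulr_ge0// powR_ge0.
exists T; first exact: addr_ge0.
move=> z; rewrite powRN -/al ler_pdivlMr ?powR_gt0 ?ltr_pwDl// mulrC.
have [Mz|/ltW zM] := leP M `|z|.
  apply: (@le_trans _ _ ((1 + M^-1) `^ al * U)); last by rewrite lerDl.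
  apply: (@le_trans _ _ ((1 + M^-1) `^ al * `|u z|)); last first.
    by rewrite ler_wpM2l ?powR_ge0// uU.
  rewrite /u normrM (ger0_norm (s0 z)) mulrA ler_wpM2r//.
  rewrite /s sqr_powR_half -powRM ?addr_ge0 ?invr_ge0 ?(ltW M0)//.
  rewrite ge0_ler_powR ?nnegrE ?(ltW al0) ?mulr_ge0 ?addr_ge0 ?invr_ge0 ?(ltW M0)//.
  by rewrite mulrDl mul1r addrC lerD2l mulrC ler_pdivlMr// mul1r.
apply: (@le_trans _ _ ((1 + M) `^ al * `|G m|)); last by rewrite lerDr.
apply: ler_pM; rewrite ?powR_ge0//.
  by rewrite ge0_ler_powR ?nnegrE ?(ltW al0) ?addr_ge0 ?(ltW M0)// lerD2l.
by apply: Gm; rewrite in_itv /= -ler_norml.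
Qed.

End profile_decay.

(** * The self-similar solutions *)

Section self_similar_bounds.
Context {R : realType}.
Local Notation mu := (@lebesgue_measure R).
Implicit Types (f : R -> R) (al c C p r s t x : R).

(** The prefactor 1/(1 - t) equals tau^(-1/(1 + l)) for tau = (1 - t)^(1 + l), so it merges with the
    decay factor of G. *)
Lemma self_similar_le (G : R -> R) C l x t : 0 < 1 + l ->
  (forall z, `|G z| <= C * (1 + `|z|) `^ (- (1 + l)^-1)) -> t \in `[0, 1[ ->
  `|self_similar l G x t| <= C * ((1 - t) `^ (1 + l) + `|x|) `^ (- (1 + l)^-1).
Proof.
move=> c0 GC; rewrite in_itv /= => /andP[t0 t1].
have t10 : 0 < 1 - t by rewrite subr_gt0.
rewrite /self_similar; set tau := (1 - t) `^ (1 + l).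
have tau0 : 0 < tau by rewrite powR_gt0.
have -> : tau + `|x| = tau * (1 + `|x / tau|).
  by rewrite normrM normfV (gtr0_norm tau0) mulrDr mulr1 mulrC mulfVK ?gt_eqF.
rewrite (powRM _ (ltW tau0)) ?addr_ge0//.
have -> : tau `^ (- (1 + l)^-1) = (1 - t)^-1.
  by rewrite /tau -powRrM mulrN mulfV ?gt_eqF// powR_inv1//; exact: ltW.
rewrite normrM gtr0_norm ?invr_gt0// mulrCA ler_wpM2l//.
by rewrite invr_ge0 ltW.
Qed.

(** |f x| > s forces tau + |x| < (C / s)^c, so the superlevel set lies in a ball of measure 2 (C /
    s)^c. The bound does not involve tau, which makes it uniform in time. *)
Lemma weakL_norm_le f C c tau : 0 < c -> 0 <= C -> 0 < tau -> measurable_fun setT f ->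
  (forall x, `|f x| <= C * (tau + `|x|) `^ (- c^-1)) ->
  (weakL_norm c f <= (2 `^ c^-1 * C)%:E)%E.
Proof.
move=> c0 C0 tau0 mf fC; apply: ge_ereal_sup => _ [s /= s0 <-].
have ci0 : 0 < c^-1 by rewrite invr_gt0.
pose r := (C / s) `^ c; have r0 : 0 <= r by exact: powR_ge0.
have sub : [set x | s < `|f x|] `<=` ball 0 r.
  move=> x /= sx; rewrite /ball /= sub0r normrN.
  have y0 : 0 < tau + `|x| by rewrite ltr_wpDr.
  have := lt_le_trans sx (fC x); rewrite powRN ltr_pdivlMr ?powR_gt0// mulrC -ltr_pdivlMr// => H.
  apply: (@lt_trans _ _ (tau + `|x|)); first by rewrite ltrDr.
  have -> : tau + `|x| = ((tau + `|x|) `^ c^-1) `^ c.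
    by rewrite -powRrM mulVf ?gt_eqF// powRr1// ltW.
  by rewrite gt0_ltr_powR// nnegrE ?powR_ge0// divr_ge0// ltW.
have mA : measurable [set x | s < `|f x|].
  have -> : [set x | s < `|f x|] = setT `&` (fun x => `|f x|) @^-1` `]s, +oo[%classic.
    by apply/seteqP; split => x; rewrite /= in_itv /= andbT //; case.
  have mn : measurable_fun setT (fun x => `|f x|) by exact: measurableT_comp.
  by apply: mn.
have muA : (mu [set x | (s < `|f x|)%R] <= (2 * r)%:E)%E.
  apply: (@le_trans _ _ (mu (ball 0 r))).
    by apply: le_measure; rewrite ?inE//; exact: measurable_ball.
  by rewrite lebesgue_measure_ball// mulr_natl.
apply: (@le_trans _ _ (s%:E * ((2 * r)%:E `^ c^-1))%E).
  rewrite lee_wpmul2l//; first by rewrite lee_fin ltW.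
  apply: gt0_ler_poweR => //; first exact: ltW; rewrite ?in_itv /= ?leey ?andbT// ?measure_ge0//.
  by rewrite lee_fin mulr_ge0.
have Cs0 : 0 <= C / s by rewrite divr_ge0// ltW.
rewrite poweR_EFin -EFinM lee_fin powRM// /r -powRrM mulfV ?gt_eqF// powRr1//.
rewrite le_eqVlt; apply/orP; left; apply/eqP; field.
by rewrite gt_eqF.
Qed.

(** A positive tau keeps the integrand continuous at 0, so no improper integral arises; the value
    stays bounded as tau tends to 0 because r > 0. *)
Lemma integral_powR_shift tau r : 0 < tau -> 0 < r ->
  (\int[mu]_(x in `[0%R, 1%R]) ((tau + `|x|) `^ (r - 1))%:E =
   (((tau + 1) `^ r - tau `^ r) / r)%:E)%E.
Proof.
move=> tau0 r0; pose F x := (tau + x) `^ r / r.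
have dF x : 0 <= x -> is_derive x 1 F ((tau + `|x|) `^ (r - 1)).
  move=> x0; have y0 : 0 < tau + x by rewrite ltr_wpDr.
  have H1 : is_derive x 1 (fun x : R => tau + x) 1.
    by rewrite -[X in is_derive _ _ _ X]add0r; apply: is_deriveD.
  have H2 := @is_derive1_comp _ (fun y => y `^ r) (fun x : R => tau + x) x _ _ (is_derive1_powR r y0) H1.
  have H3 := is_deriveZ r^-1 H2.
  have -> : F = r^-1 *: ((fun y => y `^ r) \o (fun x : R => tau + x)).
    by apply/funext => y; rewrite /F mulrC.
  apply: (is_derive_eq H3); rewrite ger0_norm// /GRing.scale /= mulr1 mulrA mulVf ?mul1r//.
  by rewrite gt_eqF.
rewrite (@continuous_FTC2 _ _ F).
- by rewrite /F addr0 -EFinB mulrBl.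
- exact: ltr01.
- apply: continuous_subspaceT => x.
  apply: (@continuous_comp _ _ _ (fun x : R => tau + `|x|) (fun y => y `^ (r - 1))).
    by apply: cvgD; [exact: cvg_cst|exact: norm_continuous].
  by apply: continuous_powRr; rewrite ltr_wpDr.
- have cF x : 0 <= x -> {for x, continuous F}.
    move=> /dF[? _]; apply/differentiable_continuous/derivable1_diffP; assumption.
  split.
  + by move=> x; rewrite in_itv /= => /andP[/ltW/dF[]].
  + by apply: cvg_at_right_filter; exact: cF.
  + by apply: cvg_at_left_filter; exact: cF.
- by move=> x; rewrite in_itv /= => /andP[/ltW/dF[_]]; rewrite derive1E.
Qed.

(** The exponent -al p exceeds -1, so the shifted power has a primitive of positive exponent r.
    Evenness gives the factor 2, and tau <= 1 gives (tau + 1)^r <= 2^r. *)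
Lemma integral_powR_le f C al p tau : 0 <= C -> 0 < tau -> tau <= 1 -> 0 < p ->
  al * p < 1 -> (forall x, `|f x| <= C * (tau + `|x|) `^ (- al)) ->
  (\int[mu]_(x in `[(-1)%R, 1%R]) (`|f x| `^ p)%:E <=
   (C `^ p * (2 * (2 `^ (1 - al * p) / (1 - al * p))))%:E)%E.
Proof.
move=> C0 tau0 tau1 p0 alp fC; set r := 1 - al * p.
have r0 : 0 < r by rewrite subr_gt0.
pose g x := (tau + `|x|) `^ (r - 1).
have cg : continuous g.
  move=> x; apply: (@continuous_comp _ _ _ (fun x : R => tau + `|x|) (fun y => y `^ (r - 1))).
    by apply: cvgD; [exact: cvg_cst|exact: norm_continuous].
  by apply: continuous_powRr; rewrite ltr_wpDr.
have mg : measurable_fun setT (fun x => (g x)%:E).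
  by apply/measurable_EFinP; exact: continuous_measurable_fun.
have g0 x : (0 <= (g x)%:E)%E by rewrite lee_fin powR_ge0.
apply: (@le_trans _ _ (\int[mu]_(x in `[(-1)%R, 1%R]) ((C `^ p)%:E * (g x)%:E))%E).
  apply: ge0_le_lower_integral => x _; first by rewrite lee_fin powR_ge0.
  rewrite -EFinM lee_fin; apply: (@le_trans _ _ ((C * (tau + `|x|) `^ (- al)) `^ p)).
    by rewrite ge0_ler_powR ?nnegrE ?(ltW p0)// mulr_ge0// powR_ge0.
  rewrite powRM ?powR_ge0// -powRrM /g /r mulNr.
  by have -> : 1 - al * p - 1 = - (al * p) by ring.
rewrite ge0_integralZl//; last 2 first.
  exact: measurable_funTS.
  by rewrite lee_fin powR_ge0.
rewrite EFinM lee_wpmul2l ?lee_fin ?powR_ge0//.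
have I1 : (\int[mu]_(x in `[0%R, 1%R]) (g x)%:E <= (2 `^ r / r)%:E)%E.
  rewrite integral_powR_shift// lee_fin ler_pM2r ?invr_gt0//.
  apply: (@le_trans _ _ ((tau + 1) `^ r)); first by rewrite gerBl powR_ge0.
  rewrite ge0_ler_powR ?nnegrE ?(ltW r0) ?addr_ge0 ?(ltW tau0)//; lra.
have I2 : (\int[mu]_(x in `[(-1)%R, 0%R]) (g x)%:E = \int[mu]_(x in `[0%R, 1%R]) (g x)%:E)%E.
  have := @integration_by_substitution_oppr R g 0 1 ler01.
  rewrite oppr0 => ->; last exact: continuous_subspaceT.
  by apply: eq_integral => x _; rewrite /g /= normrN.
have -> : `[(-1)%R, 1%R]%classic = `[(-1)%R, 0%R] `|` `]0%R, 1%R] :> set R.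
  by apply: itv_bndbnd_setU; rewrite bnd_simp//; lra.
rewrite ge0_integral_setU//; last 2 first.
  exact: measurable_funTS.
  by apply/disj_setPS => x []; rewrite /= !in_itv /= => /andP[? ?] /andP[? ?]; lra.
rewrite integral_itv_obnd_cbnd; last exact: measurable_funTS.
have -> : (2 * (2 `^ r / r))%:E = ((2 `^ r / r)%:E + (2 `^ r / r)%:E)%E.
  by rewrite -EFinD; congr EFin; ring.
by rewrite I2; exact: leeD.
Qed.

End self_similar_bounds.

Unset Implicit Arguments.

Theorem theorem2 (R : realType) (F : nat -> R -> R) (lam : nat -> R) (a0 : R)
    (Fa : R -> R -> R)
    (hF : profile_expansion F lam)
    (ha0 : 0 < a0)
    (hFa : forall a, `|a| < a0 -> expansion_solves F lam a (Fa a))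
    (a : R) (ha : `|a| < a0) :
  let lambda := lambda_sum lam a in
  let omega := self_similar lambda (Fa a) in
  [/\ forall b, 0 < b -> exists C : R,
        forall x t, x \notin `]- b, b[ -> t \in `[0, 1[ -> `|omega x t| <= C,
      Linfty_weakL (1 + lambda) omega &
      forall p, 0 < p -> p < 1 + lambda ->
        (ereal_sup [set \int[@lebesgue_measure R]_(x in `[(-1)%R, 1%R])
                          (`|omega x t| `^ p)%:E
                   | t in `[0%R, 1%R[] < +oo)%E].
Proof.
move=> lambda omega; have [[[cG [d [d0 d2 dw]]] _] _ c0 eqG] := hFa a ha.
rewrite -/lambda in c0 eqG.
have G2 : Fa a \in Lfun (@lebesgue_measure R) 2%:E by rewrite -d0; exact: d2.
have dw0 : weak_derivative (Fa a) (d 1) by rewrite -d0; exact: dw.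
have [D [cD dG D2 Dsub]] :=
  sobolev_C1 cG G2 (d2 1 isT) (d2 2 isT) dw0 (dw 1 isT).
have sq f : f \in Lfun (@lebesgue_measure R) 2%:E ->
    (\int[@lebesgue_measure R]_y (f y ^+ 2)%:E < +oo)%E.
  by move=> /Lfun2_integrable_sqr/integrable_lty; apply.
have [C C0 GC] :=
  profile_decay (IsC1Jet cD dG (d2 2 isT) Dsub) (sq _ G2) D2 (sq _ (d2 2 isT)) c0 eqG.
have ci0 : 0 < (1 + lambda)^-1 by rewrite invr_gt0.
have tau0 t : t \in `[0, 1[ -> 0 < (1 - t) `^ (1 + lambda).
  by rewrite in_itv /= => /andP[_ t1]; rewrite powR_gt0// subr_gt0.
have tau1 t : t \in `[0, 1[ -> (1 - t) `^ (1 + lambda) <= 1.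
  rewrite in_itv /= => /andP[t0 t1].
  have : (1 - t) `^ (1 + lambda) <= 1 `^ (1 + lambda).
    by rewrite ge0_ler_powR ?nnegrE ?(ltW c0)//; lra.
  by rewrite powR1.
have omC x t : t \in `[0, 1[ ->
    `|omega x t| <= C * ((1 - t) `^ (1 + lambda) + `|x|) `^ (- (1 + lambda)^-1).
  exact: self_similar_le.
have m_omega t : measurable_fun setT (omega ^~ t).
  apply: measurable_funM; first exact: measurable_cst.
  apply: (measurableT_comp (continuous_measurable_fun cG)).
  by apply: measurable_funM => //; exact: measurable_cst.
have wL t : t \in `[0, 1[ ->
    (weakL_norm (1 + lambda) (omega ^~ t) <= (2 `^ (1 + lambda)^-1 * C)%:E)%E.
  by move=> t01; apply: (weakL_norm_le c0 C0 (tau0 _ t01) (m_omega t)) => x; exact: omC.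
split.
(* Away from 0 the time drops out, because (1 - t)^(1 + lambda) + |x| >= b. *)
- move=> b b0; exists (C * b `^ (- (1 + lambda)^-1)) => x t xb t01.
  apply: le_trans (omC x t t01) _; rewrite ler_wpM2l//.
  have bx : b <= `|x|.
    by rewrite leNgt ltr_norml; move: xb; rewrite in_itv.
  have t0 := tau0 _ t01.
  rewrite !powRN lef_pV2 ?posrE ?powR_gt0 ?ltr_pwDl//.
  by rewrite ge0_ler_powR ?nnegrE ?(ltW ci0) ?(ltW b0) ?addr_ge0 ?(ltW t0)// ler_wpDl ?(ltW t0).
- split.
    by move=> t t01; split; [exact: m_omega|apply: le_lt_trans (wL t t01) _; rewrite ltry].
  apply: le_lt_trans (_ : _ <= (2 `^ (1 + lambda)^-1 * C)%:E)%E _; last exact: ltry.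
  by apply: ge_ereal_sup => _ [t t01 <-]; exact: wL.
- move=> p p0 pc.
  (* The upper bound on p is exactly what makes |x|^(-p/(1 + lambda)) integrable at 0. *)
  have alp : (1 + lambda)^-1 * p < 1 by rewrite ltr_pdivrMl// mulr1.
  apply: le_lt_trans (_ : _ <= (C `^ p *
    (2 * (2 `^ (1 - (1 + lambda)^-1 * p) / (1 - (1 + lambda)^-1 * p))))%:E)%E _; last exact: ltry.
  apply: ge_ereal_sup => _ [t t01 <-].
  apply: (integral_powR_le C0 (tau0 _ t01) (tau1 _ t01) p0 alp) => x.
  exact: omC.
Qed.
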